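(* Let $H,P$ be arbitrary finite groups. Then there is a constant $c(P)\in\mathbb{N}$, depending only on the group $P$, such that for all $\ell\geqslant c(P)$ there is a shift space $\mathbb{X}_\varrho\subseteq\mathcal{A}^{\mathbb{Z}^\ell}$ originating from an aperiodic, primitive and bijective ($\ell$-dimensional rectangular) substitution $\varrho$ such that $$\mathcal{S}(\mathbb{X}_\varrho)\simeq\mathbb{Z}^\ell\times H,\qquad \mathcal{R}(\mathbb{X}_\varrho)\simeq(\mathbb{Z}^\ell\times H)\rtimes P$$ for some action of $P$ on $\mathbb{Z}^\ell\times H$ by automorphisms.
   Context: Let $\mathcal{A}$ be a finite alphabet and $R=\prod_{i=1}^\ell[0,L_i-1]\subset\mathbb{Z}^\ell$ with $L_i\geqslant 2$. An $\ell$-dimensional rectangular substitution is a map $\varrho\colon\mathcal{A}\to\mathcal{A}^R$, extended to patterns $p$ on finite subsets of $\mathbb{Z}^\ell$ by $\varrho(p)_{Q\boldsymbol{n}+\boldsymbol{r}}=\varrho(p_{\boldsymbol{n}})_{\boldsymbol{r}}$ for $\boldsymbol{r}\in R$, with $Q=\mathrm{diag}(L_1,\dots,L_\ell)$. It is primitive if for some $k\geqslant1$ every $\varrho^k(a)$, $a\in\mathcal{A}$, contains every letter. It is bijective if for every $\boldsymbol{i}\in R$ the column $a\mapsto\varrho(a)_{\boldsymbol{i}}$ is a bijection of $\mathcal{A}$. The shift space (hull) $\mathbb{X}_\varrho\subseteq\mathcal{A}^{\mathbb{Z}^\ell}$ is the set of all $x\in\mathcal{A}^{\mathbb{Z}^\ell}$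 all of whose finite patterns occur (up to translation) in some $\varrho^k(a)$; it carries the product topology and the shift action $(\sigma_{\boldsymbol{n}}(x))_{\boldsymbol{m}}=x_{\boldsymbol{n}+\boldsymbol{m}}$ of $\mathbb{Z}^\ell$. It (and $\varrho$) is aperiodic if no $x\in\mathbb{X}_\varrho$ satisfies $\sigma_{\boldsymbol{n}}(x)=x$ for some $\boldsymbol{n}\neq\boldsymbol{0}$. The symmetry group $\mathcal{S}(\mathbb{X}_\varrho)$ and the extended symmetry group $\mathcal{R}(\mathbb{X}_\varrho)$ are, respectively, the centraliser and the normaliser of $\mathcal{G}=\{\sigma_{\boldsymbol{n}}:\boldsymbol{n}\in\mathbb{Z}^\ell\}$ in the group of all self-homeomorphisms of $\mathbb{X}_\varrho$. *)

(* Defs.v *)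
From HB Require Import structures.
From mathcomp Require Import all_boot all_order all_fingroup all_algebra.
From mathcomp Require Import finmap.
From mathcomp Require Import all_classical topology.
Set Implicit Arguments.
Unset Strict Implicit.
Unset Printing Implicit Defensive.
Import Order.TTheory GRing.Theory Num.Theory.

Local Open Scope classical_set_scope.

Section Groups.
Local Open Scope group_scope.

Definition isomorphic (G H : groupType) : Prop :=
  exists f : {multiplicative G -> H}, bijective f.

Definition centraliser_of (G : groupType) (A : set G) : set G :=
  [set g | forall a, A a -> commute g a].

Definition normaliser_of (G : groupType) (A : set G) : set G :=
  [set g | [set a ^ g | a in A] = A].

Lemma centraliser_group (G : groupType) (A : set G) :
  group_closed (fun g => g \in centraliser_of A).
Proof.
split=> [|x y]; rewrite -?topredE /= !inE /centraliser_of /= ?inE.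
  by move=> a _; exact/commute_sym/commute1.
by move=> cx cy a Aa; apply/commute_sym/commuteM;
  [exact/commute_sym/cx | exact/commuteV/commute_sym/cy].
Qed.

Lemma normaliser_group (G : groupType) (A : set G) :
  group_closed (fun g => g \in normaliser_of A).
Proof.
split=> [|x y]; rewrite -?topredE /= !inE /normaliser_of /=.
  rewrite eqEsubset; split=> a; first by case=> b Ab <-; rewrite conjg1.
  by move=> Aa; exists a; rewrite ?conjg1.
move=> nx ny; rewrite eqEsubset; split=> a.
  case=> b Ab <-; rewrite conjgM.
  have [c Ac <-] : [set c ^ y | c in A] (b ^ x) by rewrite ny -nx; exists b.
  by rewrite conjgK.
move=> Aa; have [b Ab e] : [set c ^ x | c in A] (a ^ y).
  by rewrite nx -ny; exists a.
by exists b => //; rewrite conjgM e conjgK.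
Qed.

(* Each [theta p] is an automorphism of [N], with inverse [theta p^-1]. *)
Record gaut_action (P N : groupType) := GautAction {
  gaut_act :> P -> N -> N;
  gaut_actM : forall p : P, {morph gaut_act p : m n / m * n};
  gaut_act1 : forall n : N, gaut_act 1 n = n;
  gaut_act_comp : forall (p q : P) (n : N),
    gaut_act (p * q) n = gaut_act p (gaut_act q n) }.

End Groups.

Definition sdprod_type (P N : groupType) (theta : gaut_action P N) : Type :=
  (N * P)%type.

Section SemidirectProduct.
Local Open Scope group_scope.
Variables (P N : groupType) (theta : gaut_action P N).
Notation T := (sdprod_type theta).
Implicit Types u v : T.

HB.instance Definition _ := Choice.copy T (N * P)%type.

Definition sd_mul u v : T := (u.1 * theta u.2 v.1, u.2 * v.2).
Definition sd_one : T := (1, 1).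
Definition sd_inv u : T := (theta u.2^-1 u.1^-1, u.2^-1).

Lemma gaut_act_unit p : theta p 1 = 1.
Proof. by apply: (mulgI (theta p 1)); rewrite -gaut_actM !mulg1. Qed.

Lemma sd_mulA : associative sd_mul.
Proof.
by move=> u v w; rewrite /sd_mul /= gaut_actM gaut_act_comp !mulgA.
Qed.

Lemma sd_mul1 : left_id sd_one sd_mul.
Proof. by case=> n p; rewrite /sd_mul /= gaut_act1 !mul1g. Qed.

Lemma sd_mulr1 : right_id sd_one sd_mul.
Proof. by case=> n p; rewrite /sd_mul /= gaut_act_unit !mulg1. Qed.

Lemma sd_mulV : left_inverse sd_one sd_inv sd_mul.
Proof.
by case=> n p; rewrite /sd_mul /sd_inv /= -gaut_actM !mulVg gaut_act_unit.
Qed.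

Lemma sd_mulrV : right_inverse sd_one sd_inv sd_mul.
Proof.
case=> n p; rewrite /sd_mul /sd_inv /= -gaut_act_comp !mulgV gaut_act1.
by rewrite mulgV.
Qed.

HB.instance Definition _ :=
  isGroup.Build T sd_mulA sd_mul1 sd_mulr1 sd_mulV sd_mulrV.

End SemidirectProduct.

Record homeo (T : topologicalType) := Homeo {
  homeo_fun :> T -> T;
  homeo_inv : T -> T;
  homeo_cts : continuous homeo_fun;
  homeo_inv_cts : continuous homeo_inv;
  homeoK : cancel homeo_fun homeo_inv;
  homeoVK : cancel homeo_inv homeo_fun }.

Section HomeoGroup.
Variable T : topologicalType.
Implicit Types f g h : homeo T.

Lemma homeoP f g : (f : T -> T) =1 g -> f = g.
Proof.
case: f g => f f' cf cf' fK f'K [g g' cg cg' gK g'K] /= /funext efg.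
have e' : f' = g'.
  by apply/funext => x; rewrite -{1}[x]g'K -efg fK.
by subst g g'; congr Homeo; exact: Prop_irrelevance.
Qed.

HB.instance Definition _ := gen_eqMixin (homeo T).
HB.instance Definition _ := gen_choiceMixin (homeo T).

Definition homeo_one : homeo T :=
  @Homeo T id id (fun _ => cvg_id) (fun _ => cvg_id) (fun _ => erefl)
    (fun _ => erefl).

Definition homeoV f : homeo T :=
  Homeo (@homeo_inv_cts _ f) (@homeo_cts _ f) (@homeoVK _ f) (@homeoK _ f).

Definition homeoM f g : homeo T :=
  @Homeo T (f \o g) (homeo_inv g \o homeo_inv f)
    (fun x => continuous_comp (@homeo_cts _ g x) (@homeo_cts _ f (g x)))
    (fun x => continuous_comp (@homeo_inv_cts _ f x)
                (@homeo_inv_cts _ g (homeo_inv f x)))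
    (can_comp (@homeoK _ f) (@homeoK _ g))
    (can_comp (@homeoVK _ g) (@homeoVK _ f)).

Lemma homeoMA : associative homeoM.
Proof. by move=> f g h; exact: homeoP. Qed.
Lemma homeoM1 : left_id homeo_one homeoM.
Proof. by move=> f; exact: homeoP. Qed.
Lemma homeoMr1 : right_id homeo_one homeoM.
Proof. by move=> f; exact: homeoP. Qed.
Lemma homeoMV : left_inverse homeo_one homeoV homeoM.
Proof. by move=> f; apply: homeoP => x; exact: homeoK. Qed.
Lemma homeoMrV : right_inverse homeo_one homeoV homeoM.
Proof. by move=> f; apply: homeoP => x; exact: homeoVK. Qed.

HB.instance Definition _ :=
  isGroup.Build (homeo T) homeoMA homeoM1 homeoMr1 homeoMV homeoMrV.

End HomeoGroup.

Local Open Scope ring_scope.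

Record rect_subst (l : nat) (A : finType) := RectSubst {
  side : 'I_l -> nat;
  side_ge2 : forall i, (2 <= side i)%N;
  rule : A -> (forall i, 'I_(side i)) -> A }.

Arguments rule {l A} rho a r : rename.

Section Substitution.
Variables (l : nat) (A : finType) (rho : rect_subst l A).
Notation site := 'rV[int]_l.
Notation L := (side rho).
Notation box := (forall i, 'I_(L i)).

(* A pattern on a finite subset is encoded as a partial function, with value
   [None] off the subset. *)
Notation pattern := (site -> option A).

Definition box_site (r : box) : site := \row_i (nat_of_ord (r i))%:Z.

Definition scale_site (n : site) : site := \row_i ((L i)%:Z * n 0 i).

Definition site_quo (m : site) : site := \row_i (m 0%R i %/ (L i)%:Z)%Z.

Lemma site_rem_subproof (m : site) (i : 'I_l) :
  (`|(m 0%R i %% (L i)%:Z)%Z| < L i)%N.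
Proof.
have L0 : (0 < L i)%N by exact: ltnW (side_ge2 rho i).
rewrite -ltz_nat gez0_abs ?modz_ge0 ?ltz_pmod ?ltz_nat //.
by rewrite eqz_nat -lt0n.
Qed.

Definition site_rem (m : site) : box :=
  fun i => Ordinal (site_rem_subproof m i).

(* [site_quo] and [site_rem] are the unique n and r with m = Q n + r
   (lemma [scale_quo_rem]), so that [inflateE] characterises [inflate]. *)
Definition inflate (p : pattern) : pattern :=
  fun m => omap (fun a => rule rho a (site_rem m)) (p (site_quo m)).

Lemma inflateE (p : pattern) (n : site) (r : box) :
  inflate p (scale_site n + box_site r) = omap (fun a => rule rho a r) (p n).
Proof.
have L0 i : (L i)%:Z != 0 :> int.
  by rewrite eqz_nat -lt0n; exact: ltnW (side_ge2 rho i).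
have e (i : 'I_l) : (scale_site n + box_site r) 0 i =
    n 0 i * (L i)%:Z + (nat_of_ord (r i))%:Z.
  by rewrite !mxE mulrC.
rewrite /inflate.
have -> : site_quo (scale_site n + box_site r) = n.
  apply/rowP => i; rewrite mxE e divzMDl // divz_small ?addr0 //.
  by rewrite lez_nat /= ltz_nat.
suff -> : site_rem (scale_site n + box_site r) = r by [].
apply: functional_extensionality_dep => i; apply: val_inj => /=.
by rewrite e modzMDl modz_small // lez_nat /= ltz_nat.
Qed.

Lemma scale_quo_rem (m : site) :
  scale_site (site_quo m) + box_site (site_rem m) = m.
Proof.
apply/rowP => i; rewrite !mxE /= gez0_abs; first by rewrite mulrC -divz_eq.
apply: modz_ge0; rewrite eqz_nat -lt0n; exact: ltnW (side_ge2 rho i).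
Qed.

Definition letter (a : A) : pattern := fun n => if n == 0 then Some a else None.

Definition supertile (k : nat) (a : A) : pattern := iter k inflate (letter a).

Definition primitive_subst : Prop :=
  exists2 k, (1 <= k)%N &
    forall a b : A, exists m : site, supertile k a m = Some b.

Definition bijective_subst : Prop :=
  forall r : box, bijective (fun a => rule rho a r).

Definition full_shift := {ptws site -> discrete_topology A}.

Definition shift_by (n : site) (x : full_shift) : full_shift :=
  fun m => x (n + m).

(* [F] is the support of a pattern of [x], [t] the translation carrying it
   into the pattern obtained from [a] after [k] substitution steps. *)
Definition hull : set full_shift :=
  [set x | forall F : {fset site}, exists k a (t : site),
     forall m, m \in F -> supertile k a (t + m) = Some (x m)].

Definition aperiodic_subst : Prop :=
  forall x, hull x -> forall n, shift_by n x = x -> n = 0.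

Lemma hull_shift_by n x : hull x -> hull (shift_by n x).
Proof.
move=> hx F; have [k [a [t ht]]] := hx [fset (n + m)%R | m in F]%fset.
exists k, a, (t + n) => m mF.
by rewrite -addrA ht //; apply/imfsetP; exists m.
Qed.

Definition hull_shift_fun n (x : hull) : hull :=
  exist _ (shift_by n (\val x)) (mem_set (hull_shift_by n (set_mem (valP x)))).

Lemma hull_shift_continuous n : continuous (hull_shift_fun n).
Proof.
apply: continuous_comp_initial => x.
have Fx : Filter (nbhs x) := nbhs_filter x.
apply/cvg_sup => i.
apply: (@continuous_comp_initial _ hull _ (fun f : full_shift => f i)
  (set_val \o hull_shift_fun n) _ x) => {Fx}x.
apply: (@continuous_comp _ _ _ set_val (fun f : full_shift => f (n + i))).
  exact: initial_continuous.
exact: (@proj_continuous _ (fun _ => discrete_topology A) (n + i)).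
Qed.

Lemma hull_shiftK n m : n + m = 0 ->
  cancel (hull_shift_fun n) (hull_shift_fun m).
Proof.
move=> nm0 x; apply: val_inj; apply/funext => i /=.
by rewrite /shift_by addrA nm0 add0r.
Qed.

Definition shift_homeo n : homeo hull :=
  Homeo (hull_shift_continuous (n := n)) (hull_shift_continuous (n := - n))
    (hull_shiftK (subrr n)) (hull_shiftK (addNr n)).

Definition shift_group : set (homeo hull) := range shift_homeo.

Definition symmetry_group : Type := centraliser_of shift_group.

HB.instance Definition _ := SubChoice.on symmetry_group.
HB.instance Definition _ :=
  SubChoice_isSubGroup.Build _ _ symmetry_group
    (centraliser_group shift_group).

Definition extended_symmetry_group : Type := normaliser_of shift_group.

HB.instance Definition _ := SubChoice.on extended_symmetry_group.
HB.instance Definition _ :=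
  SubChoice_isSubGroup.Build _ _ extended_symmetry_group
    (normaliser_group shift_group).

End Substitution.

(* Main.v *)
Require Import Defs.
From mathcomp Require Import all_boot all_order all_fingroup all_algebra.
From mathcomp Require Import finmap.
From mathcomp Require Import all_classical topology.
From HB Require Import structures.
From mathcomp Require Import zify.

(* Let the columns of the substitution act on A = H x {0,1,2} through the group
   G = H x S_3, so that the permutations of A commuting with all columns are
   exactly the right translations by H. Put N = l |G| and use the cube of side
   L = 2N + 1, centered at 0. All columns are the identity, except at the sites
   with coordinates l rank(g) + p(i) - N (i < l), where g is in G and p runs over
   P acting faithfully on the l coordinates; there the column is g. Coordinate
   permutations by P preserve the substitution, which gives the easy inclusion.

   Conversely, let f be a homeomorphism with f sigma_{phi n} = sigma_n f. If an
   element of the hull had two different grids of supertiles, the overlaps would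
   tie each letter to its neighbour by a fixed element of G, hence create the
   period N e_i, which the positions of the columns forbid. So the substitution is
   recognizable, and f sends csub y to a shift of csub (f1 y), where f1 has the
   same linear part phi. Columns being bijective, f1 y at 0 can be read from any
   site of the image cell; choosing it so that the window of f is centered in a
   cell divides the window by L. After finitely many steps the window is a single
   site: f x n = tau (x (phi n + c)). Doing this once more, the whole cell must
   come from a single cell, since no letter of the hull determines another one.
   Hence phi maps the cube to itself and is a signed permutation; it preserves
   the non-identity columns, so it comes from P, and tau commutes with all
   columns, so it comes from H. *)

Set Implicit Arguments.
Unset Strict Implicit.
Unset Printing Implicit Defensive.

Import Order.TTheory GRing.Theory Num.Theory.
Local Open Scope classical_set_scope.
Local Open Scope ring_scope.

(** * The centered grid *)

Section Grid.
Variables (l N : nat).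
Notation site := 'rV[int]_l.
Notation L := N.*2.+1.
Implicit Types (m n u v : site).

(* Unlike [mxE], these leave the coordinates at type [int] syntactically, as
   [lia] requires. *)
Lemma addE m n i : (m + n) 0 i = m 0 i + n 0 i. Proof. exact: mxE. Qed.
Lemma oppE m i : (- m) 0 i = - m 0 i. Proof. exact: mxE. Qed.
Lemma zeroE i : (0 : site) 0 i = 0. Proof. exact: mxE. Qed.
Lemma scaleE n k i : (n *+ k) 0 i = n 0 i * k%:Z.
Proof. by rewrite mulmxnE -mulr_natr natz. Qed.
Lemma scalezE n (z : int) i : (n *~ z) 0 i = n 0 i * z.
Proof. by case: z => k; rewrite /intmul ?oppE scaleE // NegzE mulrN. Qed.
Definition siteE := (addE, oppE, zeroE, scaleE, scalezE).

Definition small (w : nat) u := forall i, - w%:Z <= u 0 i <= w%:Z.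

Definition cell m : site := \row_i ((m 0%R i + N%:Z)%R %/ L%:Z)%Z.
Definition offset m : site := m - cell m *+ L.

Lemma cellE m i : cell m 0 i = ((m 0%R i + N%:Z)%R %/ L%:Z)%Z.
Proof. exact: mxE. Qed.

Lemma cell_offset m : m = cell m *+ L + offset m.
Proof. by rewrite /offset addrC subrK. Qed.

Lemma small_offset m : small N (offset m).
Proof.
move=> i; rewrite /offset !siteE cellE.
have := divz_eq (m 0 i + N%:Z) L%:Z.
have := modz_ge0 (m 0 i + N%:Z) (isT : L%:Z != 0).
have := ltz_pmod (m 0 i + N%:Z) (isT : 0 < L%:Z).
move: (_ %% _)%Z (_ %/ _)%Z => r q r2 r1 e; lia.
Qed.

Lemma cell_scaleD n m : cell (n *+ L + m) = n + cell m.
Proof. by apply/rowP => i; rewrite !(siteE, cellE) -addrA divzMDl. Qed.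

Lemma offset_scaleD n m : offset (n *+ L + m) = offset m.
Proof. by rewrite /offset cell_scaleD mulrnDl opprD addrACA subrr add0r. Qed.

Lemma cell_small u : small N u -> cell u = 0.
Proof.
move=> su; apply/rowP => i; rewrite !(siteE, cellE) divz_small //; have := su i; lia.
Qed.

Lemma offset_small u : small N u -> offset u = u.
Proof. by move=> su; rewrite /offset cell_small // mul0rn subr0. Qed.

Lemma small0 w : small w 0.
Proof. by move=> i; rewrite zeroE; lia. Qed.

Lemma smallN w u : small w u -> small w (- u).
Proof. by move=> su i; rewrite oppE; have := su i; lia. Qed.

Lemma cell_scale n : cell (n *+ L) = n.
Proof. by rewrite -[n *+ L]addr0 cell_scaleD cell_small ?addr0 //; exact: small0. Qed.

Lemma offset_scale n : offset (n *+ L) = 0.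
Proof. by rewrite /offset cell_scale subrr. Qed.

(** [cell] rounds [u / L] to the nearest site. Every descent below, on periods and on windows, rests
    on this bound. *)
Lemma small_cell w u : small w u -> small ((w + N) %/ L) (cell u).
Proof.
move=> su i; rewrite cellE.
have := divz_eq (u 0 i + N%:Z) L%:Z.
have := modz_ge0 (u 0 i + N%:Z) (isT : L%:Z != 0).
have := ltz_pmod (u 0 i + N%:Z) (isT : 0 < L%:Z).
have := divn_eq (w + N) L; have := ltn_pmod (w + N) (isT : 0 < L)%N.
move: (_ %% _)%Z (_ %/ _)%Z => r q; move: (_ %% _)%N (_ %/ _)%N => r' q'.
move=> d1 d2 r2 r1 e; have := su i; nia.
Qed.

Definition unit_site (i : 'I_l) : site := \row_j (j == i)%:Z.

Lemma unit_siteE i j : unit_site i 0 j = (j == i)%:Z. Proof. exact: mxE. Qed.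

Lemma site_neq0 m : m != 0 -> exists i, m 0 i != 0.
Proof.
by move=> m0; apply: contrapT => /forallNP h; case/eqP: m0; apply/rowP => i;
  rewrite zeroE; apply/eqP; apply: contrapT => /negP; exact: h.
Qed.

Definition weight m : nat := (\sum_i `|m 0%R i|)%N.

Lemma small_weight m : small (weight m) m.
Proof.
move=> i; suff : (`|m 0%R i| <= weight m)%N by lia.
by rewrite /weight (bigD1 i) //= leq_addr.
Qed.

Lemma small_fset w : exists F : {fset site}, forall u, small w u -> u \in F.
Proof.
pose site_of (r : {ffun 'I_l -> 'I_(w.*2.+1)}) : site := \row_i ((r i)%:Z - w%:Z).
exists [fset site_of r | r in {ffun 'I_l -> 'I_(w.*2.+1)}]%fset => u su.
pose r := [ffun i => inord (absz (u 0 i + w%:Z))] : {ffun 'I_l -> 'I_(w.*2.+1)}.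
suff uE : u = site_of r by apply/imfsetP; exists r.
by apply/rowP => i; rewrite [RHS]mxE ffunE; have sui := su i; rewrite inordK; lia.
Qed.

End Grid.

Lemma onto_inj (T : finType) (h : T -> T) : (forall b, exists a, h a = b) -> injective h.
Proof.
move=> /choice[k hk]; have [k' kk' k'k] := injF_bij (can_inj (hk : cancel k h)).
by apply: can_inj (k) _ => a; rewrite -{1}[a]k'k hk k'k.
Qed.

(** * Coordinate permutations of sites *)

Section CoordinatePermutation.
Variables (l : nat) (P : groupType) (pact : P -> 'I_l -> 'I_l).
Notation site := 'rV[int]_l.

(* A right action of [P]: [psite p (psite q u) = psite (q * p) u]. *)
Definition psite (p : P) (u : site) : site := \row_i u 0 (pact p i).

(** In its uses [eps i] is -1, 0 or 1 and [pi] is any map: this is what preserving the cube alone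
    forces on a linear map. *)
Definition signed_site (eps : 'I_l -> int) (pi : 'I_l -> 'I_l) (u : site) : site :=
  \row_i (eps i * u 0 (pi i)).

Lemma psiteE p u i : psite p u 0 i = u 0 (pact p i).
Proof. exact: mxE. Qed.

Lemma psiteD p : {morph psite p : u v / u + v}.
Proof. by move=> u v; apply/rowP => i; rewrite psiteE !siteE !psiteE. Qed.

Hypothesis pact1 : forall i, pact 1%g i = i.
Hypothesis pactM : forall p q i, pact (p * q)%g i = pact p (pact q i).

Lemma psiteM p q u : psite p (psite q u) = psite (q * p)%g u.
Proof. by apply/rowP => i; rewrite !psiteE pactM. Qed.

Lemma psite1 u : psite 1%g u = u.
Proof. by apply/rowP => i; rewrite psiteE pact1. Qed.

Lemma psiteK p : cancel (psite p) (psite p^-1%g).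
Proof. by move=> u; rewrite psiteM mulgV psite1. Qed.

Lemma psiteVK p : cancel (psite p^-1%g) (psite p).
Proof. by move=> u; rewrite psiteM mulVg psite1. Qed.

Lemma psite0 p : psite p 0 = 0.
Proof. by apply/rowP => i; rewrite psiteE !zeroE. Qed.

Lemma psiteN p u : psite p (- u) = - psite p u.
Proof. by apply/rowP => i; rewrite psiteE !siteE psiteE. Qed.

End CoordinatePermutation.

(** The explicit map goes from the abstract group [K] to the group [G] of symmetries; the wanted
    isomorphism is its inverse. *)
Lemma isomorphic_of_inverse (G K : groupType) (F : K -> G) :
    {morph F : x y / (x * y)%g} -> (forall x, F x = 1%g -> x = 1%g) ->
  (forall y, exists x, F x = y) -> isomorphic G K.
Proof.
move=> FM Fker /choice[F' F'K].
have F1 : F 1%g = 1%g by apply: (mulgI (F 1%g)); rewrite -FM !mulg1.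
have Finj : injective F.
  move=> x y e; apply: (mulIg y^-1%g); rewrite mulgV.
  by apply: Fker; rewrite FM e -FM mulgV.
have FK : cancel F F' by move=> x; apply: Finj; rewrite F'K.
have F'M : {morph F' : x y / (x * y)%g} by move=> x y; apply: Finj; rewrite FM !F'K.
pose f : {multiplicative G -> K} := HB.pack F' (isMultiplicative.Build G K F' F'M).
by exists f; exists F.
Qed.

(** * Topology of the hull *)

Section HullTopology.
Variables (l : nat) (A : finType) (rho : rect_subst l A).
Notation site := 'rV[int]_l.
Notation X := (hull rho).
Notation full := (full_shift l A).

Lemma relabel_continuous (h : A -> A) (k : site -> site) (F : X -> X) :
  (forall x m, \val (F x) m = h (\val x (k m))) -> continuous F.
Proof.
move=> FE; apply: continuous_comp_initial => x.
have Fx : Filter (nbhs x) := nbhs_filter x.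
apply/cvg_sup => i.
apply: (@continuous_comp_initial _ X _ (fun f : full => f i)
  (set_val \o F) _ x) => {Fx}x.
have -> : (fun f : full => f i) \o (set_val \o F) =
    (h : discrete_topology A -> discrete_topology A) \o (fun f : full => f (k i)) \o set_val.
  by apply/funext => y; exact: FE.
apply: continuous_comp; first exact: initial_continuous.
apply: continuous_comp.
  exact: (@proj_continuous _ (fun _ => discrete_topology A) (k i)).
move=> U /nbhs_singleton Uh; rewrite nbhs_simpl /=.
by apply: filterS (discrete_set1 _) => _ ->.
Qed.

(** The cylinders at [x] form a filter converging in each coordinate, hence in the product;
    conversely a cylinder is a finite intersection of coordinate conditions. *)
Lemma nbhs_cylinder (x : full) (U : set full) :
  nbhs x U <-> exists w, forall y, (forall u, small w u -> x u = y u) -> U y.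
Proof.
pose C : set_system full :=
  [set U | exists w, forall y, (forall u, small w u -> x u = y u) -> U y].
have small_le w w' (u : site) : (w <= w')%N -> small w u -> small w' u.
  by move=> ww' su i; have := su i; lia.
have FC : Filter C.
  split; first by exists 0%N.
    move=> U1 U2 [w1 h1] [w2 h2]; exists (maxn w1 w2) => y xy.
    split; [apply: h1|apply: h2] => u su; apply: xy; apply: small_le su; lia.
  by move=> U1 U2 U12 [w h]; exists w => y xy; exact/U12/h.
split=> [xU|[w hw]].
  suff : C --> x by apply.
  apply/cvg_sup => i; apply/cvg_image.
    by rewrite eqEsubset; split=> // a _; exists (fun=> a).
  move=> V /=; rewrite nbhs_simpl => Vx.
  exists [set y : full | V (y i)]; first exists (weight i).
    by move=> y xy; rewrite /= -xy; [exact: nbhs_singleton|exact: small_weight].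
  by rewrite eqEsubset; split=> [a [y Vy <-] //|a Va]; exists (fun=> a).
have [R hR] := small_fset l w.
have Fx : Filter (nbhs x) := nbhs_filter x.
apply: filterS (_ : nbhs x (\bigcap_(u in [set` R]) [set y : full | x u = y u])).
  by move=> y xy; apply: hw => u /hR/xy.
apply: filter_bigI => u _.
have pc := @proj_continuous _ (fun _ => discrete_topology A) u x.
have := pc _ (discrete_set1 (x u)).
by rewrite nbhs_simpl /=; apply: filterS => y /= <-.
Qed.

Lemma hull_closed : closed (hull rho).
Proof.
move=> x clx F.
pose w := (\sum_(m <- F) weight m)%N.
have [|y [Xy xy]] := clx [set y | forall u, small w u -> x u = y u].
  by apply/nbhs_cylinder; exists w.
have [k [a [t ht]]] := Xy F; exists k, a, t => m mF; rewrite ht // xy //.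
have mw : (weight m <= w)%N by rewrite /w (big_fsetD1 m) //= leq_addr.
by move=> i; have := small_weight m i; lia.
Qed.

Lemma hull_compact : compact (hull rho).
Proof.
apply: (subclosed_compact hull_closed (B := [set: full])) => //.
have cA : compact [set: discrete_topology A].
  by apply: finite_compact; exact: (@finite_finset A setT).
have := @tychonoff site (fun=> discrete_topology A) (fun=> setT) (fun=> cA).
by congr compact; rewrite eqEsubset; split.
Qed.

(** The Curtis-Hedlund-Lyndon argument: continuity gives a radius near each point, compactness a
    common one. *)
Lemma continuous_window (g : X -> X) : continuous g ->
  exists w, forall x y : X, (forall u, small w u -> \val x u = \val y u) ->
    \val (g x) 0 = \val (g y) 0.
Proof.
move=> gc; have /compact_near_coveringP cov := hull_compact.
pose P (w : nat) (z : full) := forall x y : X, \val x = z ->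
  (forall u, small w u -> \val x u = \val y u) -> \val (g x) 0 = \val (g y) 0.
have [|w _ hw] := cov nat \oo P _.
  move=> z Xz; pose x0 : X := exist _ z (mem_set Xz).
  have : nbhs x0 [set y : X | \val (g y) 0 = \val (g x0) 0].
    have ev : continuous (fun y : X => (\val (g y) : full) 0).
      move=> y; apply: (@continuous_comp _ _ _ g (fun y : X => (\val y : full) 0)).
        exact: gc.
      apply: (@continuous_comp _ _ _ set_val (fun y : full => y 0)).
        exact: initial_continuous.
      exact: (@proj_continuous _ (fun _ => discrete_topology A) 0).
    exact: ev (discrete_set1 _).
  rewrite nbhsE => -[_ [[O oO <-] Oz] OV].
  have /nbhs_cylinder[w hw] := open_nbhs_nbhs (conj oO Oz).
  exists ([set x | forall u, small w u -> z u = x u], [set n | (w <= n)%N]).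
    by split; [apply/nbhs_cylinder; exists w | exists w].
  move=> [z' n] [/= zz' wn] x y xz' xy.
  have gE (v : X) : (forall u, small w u -> z u = \val v u) ->
      \val (g v) 0 = \val (g x0) 0 by move=> /hw; exact: OV.
  rewrite !gE // => u su; rewrite zz' // -xz' // xy // => i.
  by have := su i; lia.
exists w => x y; apply: (hw w) => //; first exact: leqnn.
exact/set_mem/(valP x).
Qed.

End HullTopology.

(** * Substitutions with columns in a group *)

Section ColumnSubstitution.
Variables (l N : nat) (G : finGroupType) (A : finType).
Variables (act : G -> A -> A) (th : 'rV[int]_l -> G).
Hypothesis N_gt0 : (0 < N)%N.
Notation site := 'rV[int]_l.
Notation config := (site -> A).
Notation L := N.*2.+1.
Notation cell := (cell N).
Notation offset := (offset N).

Lemma side_subproof (i : 'I_l) : (2 <= L)%N.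
Proof. by lia. Qed.

Definition col_subst : rect_subst l A :=
  RectSubst side_subproof (fun a r => act (th (\row_i ((r i)%:Z - N%:Z))) a).

Notation X := (hull col_subst).

(* The substitution with the cube of side [L] recentered at [0]. *)
Definition csub (x : config) : config := fun m => act (th (offset m)) (x (cell m)).

Definition csuper (k : nat) (a : A) : site -> option A :=
  iter k (fun p m => omap (act (th (offset m))) (p (cell m))) (letter a).

Definition translate (n : site) (x : config) : config := fun m => x (n + m).

(** Moving the origin of the cell from its corner to its center displaces supertiles by [c k], where
    [c k.+1] is [c k *+ L + const_mx N]. *)
Lemma csuperE : exists c : nat -> site,
  forall k a m, supertile col_subst k a (m + c k) = csuper k a m.
Proof.
exists (fun k => iter k (fun c => c *+ L + const_mx N%:Z) 0).
elim=> [|k IH] a m /=; first by rewrite addr0.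
set c := iter k _ _; rewrite /inflate -IH -/c.
have cE : site_quo col_subst (m + (c *+ L + const_mx N%:Z)) = cell m + c.
  apply/rowP => i; rewrite mxE !siteE /= [const_mx _ _ _]mxE.
  by rewrite addrCA divzMDl // cellE [RHS]addrC.
rewrite cE; congr (omap (act (th _)) _).
apply/rowP => i; rewrite mxE /= gez0_abs ?modz_ge0 //.
rewrite !siteE cellE [const_mx _ _ _]mxE addrCA modzMDl.
rewrite {1}[in LHS]/modz; lia.
Qed.

Lemma hullP (x : config) : X x <->
  forall F : {fset site}, exists k a t, forall m, m \in F ->
    csuper k a (t + m) = Some (x m).
Proof.
have [c cE] := csuperE; split=> hx F; have [k [a [t ht]]] := hx F.
  by exists k, a, (t - c k) => m mF; rewrite -cE addrAC subrK ht.
by exists k, a, (t + c k) => m mF; rewrite addrAC cE ht.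
Qed.

(** * Inflation, desubstitution and minimality *)

Hypothesis act1 : forall a, act 1%g a = a.
Hypothesis actM : forall g h a, act (g * h)%g a = act g (act h a).
Hypothesis th0 : th 0 = 1%g.
Hypothesis act_trans : forall a b, exists g, act g a = b.
Hypothesis th_onto : forall g, exists2 u, small N u & th u = g.

Lemma cols_trans a b : exists2 u, small N u & act (th u) a = b.
Proof.
by have [g <-] := act_trans a b; have [u su <-] := th_onto g; exists u.
Qed.

Lemma actK g : cancel (act g) (act g^-1%g).
Proof. by move=> a; rewrite -actM mulVg act1. Qed.

Lemma actKV g : cancel (act g^-1%g) (act g).
Proof. by move=> a; rewrite -actM mulgV act1. Qed.

Lemma bijective_col_subst : bijective_subst col_subst.
Proof.
move=> r; exists (act (th (\row_i ((r i)%:Z - N%:Z)))^-1%g).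
  exact: actK.
exact: actKV.
Qed.

Lemma translateD n m x : translate n (translate m x) = translate (m + n) x.
Proof. by apply/funext => k; rewrite /translate addrA. Qed.

Lemma translate0 x : translate 0 x = x.
Proof. by apply/funext => k; rewrite /translate add0r. Qed.

Lemma translate_inj n : injective (translate n).
Proof.
by move=> x y /(congr1 (translate (- n))); rewrite !translateD subrr !translate0.
Qed.

Lemma csub_translate n x : csub (translate n x) = translate (n *+ L) (csub x).
Proof.
by apply/funext => m; rewrite /csub /translate cell_scaleD offset_scaleD.
Qed.

Lemma csub_small x n u : small N u -> csub x (n *+ L + u) = act (th u) (x n).
Proof.
by move=> su; rewrite /csub cell_scaleD offset_scaleD cell_small // offset_small ?addr0.
Qed.

Lemma csub_scale x n : csub x (n *+ L) = x n.
Proof. by rewrite -[n *+ L]addr0 csub_small ?th0 ?act1 //; exact: small0. Qed.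

Lemma csub_inj : injective csub.
Proof. by move=> x y xy; apply/funext => n; rewrite -[LHS]csub_scale xy csub_scale. Qed.

Lemma csuperS k a m : csuper k.+1 a m = omap (act (th (offset m))) (csuper k a (cell m)).
Proof. by []. Qed.

(** As the central column is the identity, each supertile sits unchanged at the center of the next
    one. *)
Lemma csuper_mono k a m b : csuper k a m = Some b -> csuper k.+1 a m = Some b.
Proof.
elim: k m b => [|k IH] m b; last first.
  rewrite csuperS; case e: (csuper k a (cell m)) => [b'|] // -[<-].
  by rewrite csuperS (IH _ _ e).
rewrite csuperS /= /letter; case: eqP => // -> [<-].
rewrite cell_small ?offset_small; try exact: small0.
by rewrite eqxx /= th0 act1.
Qed.

Lemma hull_translate n x : X x -> X (translate n x).
Proof. exact: hull_shift_by. Qed.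

Lemma hull_csub x : X x -> X (csub x).
Proof.
move=> /hullP hx; apply/hullP => F; have [k [a [t ht]]] := hx [fset cell m | m in F]%fset.
exists k.+1, a, (t *+ L) => m mF.
rewrite csuperS cell_scaleD offset_scaleD ht //.
by apply/imfsetP; exists m.
Qed.

(* One residue of the grid origin modulo [L] serves all finite patterns: a finite
   set of patterns excluding every residue would be a single pattern of [x]. *)
Lemma hull_desubst x : X x -> exists n y, X y /\ x = translate n (csub y).
Proof.
move=> /hullP hx.
have [u hu] : exists u, forall F : {fset site}, exists k a t, offset t = u /\
    forall m, m \in F -> csuper k.+1 a (t + m) = Some (x m).
  apply: contrapT => /forallNP bad.
  have /choice[F hF] u := (existsNP _).2 (bad u).
  have [R hR] := small_fset l N.
  have [k [a [t ht]]] := hx (\bigcup_(u <- R) F u)%fset.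
  apply: (hF (offset t)); exists k, a, t; split=> // m mF.
  by apply/csuper_mono/ht/bigfcupP; exists (offset t); rewrite // hR //; exact: small_offset.
(* The central column being the identity, the centers of the cells carry the letters of the
   preimage. *)
pose y : config := fun n => x (n *+ L - u).
have key k a t j : offset t = u ->
    csuper k.+1 a (t + (j *+ L - u)) = csuper k a (cell t + j).
  move=> tu; rewrite (_ : t + _ = (cell t + j) *+ L); last first.
    by rewrite {1}(cell_offset N t) tu mulrnDl addrACA subrr addr0.
  rewrite csuperS cell_scale offset_scale th0.
  by case: csuper => //= b; rewrite act1.
exists u, y; split.
  apply/hullP => F; have [k [a [t [tu ht]]]] := hu [fset j *+ L - u | j in F]%fset.
  exists k, a, (cell t) => m mF; rewrite -key //; apply: ht.
  by apply/imfsetP; exists m.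
apply/funext => m; rewrite /translate /csub /y.
have [k [a [t [tu ht]]]] := hu [fset m; cell (u + m) *+ L - u]%fset.
have e : t + m = cell t *+ L + (u + m) by rewrite {1}(cell_offset N t) tu addrA.
have := ht m; rewrite !inE eqxx => /(_ isT); rewrite e csuperS cell_scaleD offset_scaleD.
have := ht (cell (u + m) *+ L - u); rewrite !inE eqxx orbT => /(_ isT).
by rewrite key // => -> [].
Qed.

(** Desubstituting [k] times reduces this to finding the letter [a], which occurs in every cell
    since the columns are transitive. *)
Lemma csuper_occurs k a x : X x ->
  exists n, forall m b, csuper k a m = Some b -> x (n + m) = b.
Proof.
elim: k x => [|k IH] x /hull_desubst[n [y [Xy ->]]].
  have [u su <-] := cols_trans (y 0) a.
  exists (u - n) => m b; rewrite /= /letter; case: eqP => // -> [<-].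
  by rewrite /translate addr0 addrC subrK -(csub_small y 0 su) mul0rn add0r.
have [j hj] := IH y Xy.
exists (j *+ L - n) => m b; rewrite csuperS.
case e: csuper => [b'|] //= [<-].
by rewrite /translate addrA [n + _]addrC subrK /csub cell_scaleD offset_scaleD (hj _ _ e).
Qed.

Lemma hull_minimal x z (F : {fset site}) : X x -> X z ->
  exists n, forall m, m \in F -> translate n x m = z m.
Proof.
move=> Xx /hullP/(_ F)[k [a [t ht]]]; have [n hn] := csuper_occurs k a Xx.
by exists (n + t) => m mF; rewrite /translate -addrA; apply/hn/ht.
Qed.

Lemma hull_letter m a x : X x -> exists2 z, X z & z m = a.
Proof.
move=> Xx; have [n hn] := csuper_occurs 0 a Xx.
exists (translate (n - m) x); first exact: hull_translate.
by rewrite /translate subrK -[n]addr0; apply: hn; rewrite /= /letter eqxx.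
Qed.

Lemma primitive_col_subst : primitive_subst col_subst.
Proof.
exists 1%N => // a b; have [u su <-] := cols_trans a b; have [c cE] := csuperE.
exists (u + c 1%N); rewrite cE csuperS /= /letter.
by rewrite cell_small // offset_small // eqxx.
Qed.

(** The supertiles of [a] are nested and exhaust the lattice; their union is the point [x]. By
    [csuper_def] the default [a] is never taken. *)
Lemma hull_nonempty (a : A) : exists x, X x.
Proof.
pose x m : A := if csuper (weight m) a m is Some b then b else a.
have csuper_def k m : small k m -> exists b, csuper k a m = Some b.
  elim: k m => [|k IH] m sm.
    exists a; rewrite /= /letter (_ : m = 0) ?eqxx //; apply/rowP => i.
    by have := sm i; rewrite zeroE; lia.
  have wk : ((k.+1 + N) %/ L <= k)%N by rewrite -ltnS ltn_divLR //; nia.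
  have [i|b e] := IH (cell m); first by have := small_cell N sm i; lia.
  by exists (act (th (offset m)) b); rewrite csuperS e.
have mono k j m b : csuper k a m = Some b -> csuper (k + j) a m = Some b.
  by move=> e; elim: j => [|j IH]; rewrite ?addn0 // addnS; exact: csuper_mono.
exists x; apply/hullP => F.
exists (\sum_(m <- F) weight m)%N, a, 0 => m mF; rewrite add0r /x.
have [b e] := csuper_def _ _ (small_weight m).
rewrite (big_fsetD1 m) //= e; exact: mono.
Qed.

(** * Recognizability and aperiodicity *)

Hypothesis cardG_dvd : (#|G| %| N)%N.
Hypothesis act_nofix : forall a, exists g, act g a <> a.
Hypothesis th_line : forall g i, exists u, [/\ small N u,
  small N (u + unit_site i *+ N), th u = g & th (u + unit_site i *+ N) = 1%g].

Lemma csub_small0 x u : small N u -> csub x u = act (th u) (x 0).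
Proof. by move=> su; rewrite -(csub_small x 0 su) mul0rn add0r. Qed.

(** Iterating [N] times applies [g ^+ N], which is 1 because [#|G|] divides [N]. *)
Lemma step_period (x : config) d g : (forall j, x (j + d) = act g (x j)) ->
  translate (d *+ N) x = x.
Proof.
move=> xd; apply/funext => j; rewrite /translate addrC.
suff -> n : x (j + d *+ n) = act (g ^+ n)%g (x j).
  have /dvdnP[q ->] : (#[g]%g %| N)%N.
    by apply: dvdn_trans cardG_dvd; rewrite -cardsT (@cardSg _ [set: G]%G <[g]>%G) ?finset.subsetT.
  by rewrite mulnC expgM expg_order expg1n act1.
elim: n => [|n IH]; first by rewrite addr0 expg0 act1.
by rewrite mulrSr addrA xd IH -actM expgS.
Qed.

(* The cell of [y] around [n] meets the cells of [x] around [n] (through [p]) and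
   around [n + d] (through [p']), whatever [n] is. *)
Lemma shared_cells_period (x y : config) u p p' a b d :
    csub x = translate u (csub y) ->
    small N p -> small N p' -> small N a -> small N b ->
    u + a = p -> u + b + d *+ L = p' ->
  translate (d *+ N) x = x.
Proof.
move=> xy sp sp' sa sb pE p'E.
apply: (@step_period _ _ ((th b)^-1 * th p' * ((th p)^-1 * th a))%g) => j.
have e1 : act (th a) (x j) = act (th p) (y j).
  by rewrite -!csub_small // xy /translate -pE addrCA.
have e2 : act (th b) (x (j + d)) = act (th p') (y j).
  rewrite -!csub_small // xy /translate -p'E; congr csub.
  by apply/rowP => k; rewrite !siteE; lia.
by rewrite !actM e1 actK -e2 actK.
Qed.

Lemma two_grids_axis_period (x y : config) n : csub x = translate n (csub y) ->
  offset n != 0 -> exists i, translate (unit_site i *+ N) x = x.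
Proof.
rewrite {1}(cell_offset N n) -translateD -csub_translate.
move: (translate _ y) (small_offset N n) => {}y su xy /site_neq0[i ui].
move: (offset n) => u in su xy ui *; exists i; have sui := su i.
(* [P s] lies in a cell of [y], [Q s] in a cell of [x]. The values [N] and [-N] of [s] in [P] pick
   opposite faces of the cell of [y]; as [u 0 i] is nonzero, they meet neighbouring cells of [x]. *)
pose P (s : int) : site := \row_j (if j == i then s else u 0 j).
pose Q (s : int) : site := \row_j (if j == i then s else 0).
have PE s j : P s 0 j = if j == i then s else u 0 j by exact: mxE.
have QE s j : Q s 0 j = if j == i then s else 0 by exact: mxE.
have [u0|u0] := ltrP 0 (u 0 i).
  have : translate (- unit_site i *+ N) x = x; last first.
    by move=> h; rewrite -{1}h translateD mulNrn addNr translate0.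
  apply: (@shared_cells_period x y u (P N%:Z) (P (- N%:Z))
    (Q (N%:Z - u 0 i)) (Q (N%:Z + 1 - u 0 i))) => //.
  - by move=> j; rewrite PE; case: eqP => // _; lia.
  - by move=> j; rewrite PE; case: eqP => // _; lia.
  - by move=> j; rewrite QE; case: eqP => _; lia.
  - by move=> j; rewrite QE; case: eqP => _; lia.
  - by apply/rowP => j; rewrite !siteE PE QE; case: eqP => [->|_] /=; rewrite ?addr0 //; lia.
  - by apply/rowP => j; rewrite !siteE PE QE unit_siteE; case: eqP => [->|_] /=; lia.
apply: (@shared_cells_period x y u (P (- N%:Z)) (P N%:Z)
  (Q (- N%:Z - u 0 i)) (Q (- N%:Z - 1 - u 0 i))) => //.
- by move=> j; rewrite PE; case: eqP => // _; lia.
- by move=> j; rewrite PE; case: eqP => // _; lia.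
- by move=> j; rewrite QE; case: eqP => _; lia.
- by move=> j; rewrite QE; case: eqP => _; lia.
- by apply/rowP => j; rewrite !siteE PE QE; case: eqP => [->|_] /=; rewrite ?addr0 //; lia.
- by apply/rowP => j; rewrite !siteE PE QE unit_siteE; case: eqP => [->|_] /=; lia.
Qed.

(** The period would equate the letters at two sites of one cell with columns [g] and 1, while [g]
    is chosen to move the letter of that cell. *)
Lemma no_axis_period x i : X x -> translate (unit_site i *+ N) x <> x.
Proof.
move=> /hull_desubst[n [z [_ ->]]]; rewrite translateD addrC -translateD.
move=> /translate_inj zE.
have [g gz] := act_nofix (z 0); have [u [su su' thu thu']] := th_line g i.
by apply: gz; rewrite -thu -csub_small0 // -zE /translate addrC csub_small0 // thu' act1.
Qed.

Lemma recognizable x y n : X x -> X y -> csub x = translate n (csub y) ->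
  exists2 k, n = k *+ L & x = translate k y.
Proof.
move=> Xx Xy xy; have [n0|n0] := eqVneq (offset n) 0; last first.
  by have [i /(no_axis_period Xx)] := two_grids_axis_period xy n0.
exists (cell n); first by rewrite {1}(cell_offset N n) n0 addr0.
by apply: csub_inj; rewrite csub_translate xy {1}(cell_offset N n) n0 addr0.
Qed.

Lemma shrunk_window_lt w : (0 < w)%N -> ((w + N) %/ L < w)%N.
Proof. by move=> w0; rewrite ltn_divLR //; nia. Qed.

(** By recognizability a period of an inflated point is [L] times a period of its preimage, which
    lies in a smaller box: infinite descent. *)
Lemma aperiodic x n : X x -> translate n x = x -> n = 0.
Proof.
have [w] : exists w, small w n by exists (weight n); exact: small_weight.
elim/ltn_ind: w n x => w IH n x sn /[dup] Xx /hull_desubst[k [y [Xy xE]]] per.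
have [w0|w0] := posnP w; first by apply/rowP => i; have := sn i; rewrite zeroE; lia.
have : csub y = translate n (csub y).
  by apply: (@translate_inj k); rewrite -xE -{1}per xE !translateD addrC.
move=> /(recognizable Xy Xy)[m nE yE].
suff m0 : m = 0 by rewrite nE m0 mul0rn.
apply: (IH _ (shrunk_window_lt w0) _ y) => //.
by rewrite -(cell_scale N m) -nE; exact: small_cell.
Qed.

Lemma aperiodic_col_subst : aperiodic_subst col_subst.
Proof. by move=> x Xx n; exact: aperiodic. Qed.

(** The center [c] is kept apart from the radius [w]: renormalization may move the center, and only
    the radius has to decrease. *)
Definition window (f : config -> config) (w : nat) (c : site) :=
  forall x y, X x -> X y -> (forall u, small w u -> x (c + u) = y (c + u)) ->
  f x 0 = f y 0.

(* To belong to a given residue class of grids is a closed condition, and there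
   are finitely many disjoint classes. *)
Lemma hull_class_local x r z : X z -> x = translate r (csub z) ->
  exists F : {fset site}, forall y, X y -> (forall m, m \in F -> y m = x m) ->
    exists2 z', X z' & y = translate r (csub z').
Proof.
move=> Xz xE.
(* For a grid [u] outside the class of [r], the site [m] witnesses that [x] is not inflated on that
   grid. *)
have bad u : exists m, offset (u - r) = 0 \/
    x m <> act (th (offset (u + m))) (x (cell (u + m) *+ L - u)).
  have [u0|u0] := eqVneq (offset (u - r)) 0; first by exists 0; left.
  apply: contrapT => /forallNP good.
  suff zE : csub z = translate (u - r) (csub (fun n => x (n *+ L - u))).
    by have [i /(no_axis_period Xz)] := two_grids_axis_period zE u0.
  apply/funext => m; have /not_orP[_ /contrapT] := good (m - r).
  by rewrite {1}xE /translate addrC subrK => ->; rewrite /csub -addrA [- r + m]addrC.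
have [F hF] := choice bad; have [R hR] := small_fset l N.
exists (\bigcup_(u <- R) [fset F u; cell (u + F u) *+ L - u])%fset => y.
move=> /[dup] Xy /hull_desubst[n [z' [Xz' yE]]] yx.
set u := offset n; have uR : u \in R by apply/hR/small_offset.
have yE' : y = translate u (csub (translate (cell n) z')).
  by rewrite csub_translate translateD -cell_offset.
have [ur|] := hF u; last first.
  rewrite -yx; last by apply/bigfcupP; exists u; rewrite ?uR // !inE eqxx.
  rewrite -yx; last by apply/bigfcupP; exists u; rewrite ?uR // !inE eqxx orbT.
  rewrite yE' /translate -/(translate _ _) [u + (_ - u)]addrC subrK csub_scale.
  by case.
have uE : u = cell (u - r) *+ L + r.
  by rewrite -{1}[u](subrK r) {1}(cell_offset N (u - r)) ur addr0.
exists (translate (cell (u - r)) (translate (cell n) z')).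
  by do 2 apply: hull_translate.
by rewrite [in RHS]csub_translate translateD -uE.
Qed.

(* [B] would be a permutation of finite order, making [e *+ #[B]] a period. *)
Lemma letter_independence (B : A -> A) d e : (forall b, exists a, B a = b) ->
  (forall x, X x -> x (d + e) = B (x d)) -> A -> e = 0.
Proof.
move=> /onto_inj Binj Be a0; have [x Xx] := hull_nonempty a0.
pose s := perm Binj.
have xe m k : x (m + e *+ k) = (s ^+ k)%g (x m).
  elim: k => [|k IH]; first by rewrite mulr0n addr0 expg0 perm1.
  rewrite expgSr permM -IH permE.
  have := Be _ (hull_translate (m + e *+ k - d) Xx).
  rewrite /translate subrK => <-; congr x.
  by apply/rowP => i; rewrite !siteE; lia.
have e0 : e *+ #[s]%g = 0.
  apply: (aperiodic Xx); apply/funext => m.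
  by rewrite /translate addrC xe expg_order perm1.
apply/rowP => i; have := congr1 (fun v : site => v 0 i) e0.
by rewrite /= !siteE; have := order_gt0 s; nia.
Qed.

Variables (P : finGroupType) (pact : P -> 'I_l -> 'I_l).

Notation psite := (psite pact).

Hypothesis act_faithful : forall g, (forall a, act g a = a) -> g = 1%g.
Hypothesis th_psite : forall p u, th (psite p u) = th u.
Hypothesis th_rigid : forall (eps : 'I_l -> int) (pi : 'I_l -> 'I_l),
    (forall i, - 1 <= eps i <= 1) ->
    (forall u, small N u -> th (signed_site eps pi u) = 1%g <-> th u = 1%g) ->
  exists p, forall u, signed_site eps pi u = psite p u.

Lemma cell_psite p u : cell (psite p u) = psite p (cell u).
Proof. by apply/rowP => i; rewrite psiteE !cellE psiteE. Qed.

Lemma offset_psite p u : offset (psite p u) = psite p (offset u).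
Proof. by apply/rowP => i; rewrite psiteE !siteE cell_psite !psiteE. Qed.

Definition equivariant (tau : A -> A) := forall g a, tau (act g a) = act g (tau a).

(** Normal forms survive inflation, since [tau] commutes with the columns and [psite p] preserves
    their positions. *)
Lemma csub_equivariant tau p n y : equivariant tau ->
  csub (fun m => tau (y (psite p m + n))) = fun m => tau (csub y (psite p m + n *+ L)).
Proof.
move=> tau_eq; apply/funext => m; rewrite /csub /= [_ + n *+ L]addrC cell_scaleD offset_scaleD.
by rewrite -tau_eq offset_psite th_psite cell_psite addrC.
Qed.

(** * Rigidity of homeomorphisms normalising the shifts *)

Section Normaliser.
Variables phi psi : site -> site.
Hypothesis phiD : {morph phi : m n / m + n}.
Hypotheses (phiK : cancel phi psi) (psiK : cancel psi phi).

Lemma phi0 : phi 0 = 0.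
Proof. by apply: (addrI (phi 0)); rewrite -phiD !addr0. Qed.

Lemma phiN m : phi (- m) = - phi m.
Proof. by apply: (addrI (phi m)); rewrite -phiD !subrr phi0. Qed.

Lemma phiMn k m : phi (m *+ k) = phi m *+ k.
Proof. by elim: k => [|k IH]; rewrite ?mulr0n ?phi0 // !mulrS phiD IH. Qed.

Lemma phiMz (z : int) m : phi (m *~ z) = phi m *~ z.
Proof. by case: z => k; rewrite /intmul ?phiN phiMn. Qed.

(** What a homeomorphism normalising the shifts becomes as a map of configurations, constrained on
    the hull only; continuity is recorded by [window]. *)
Record twisted (f : config -> config) : Prop := Twisted {
  twisted_hull : forall x, X x -> X (f x);
  twisted_onto : forall z, X z -> exists2 x, X x & f x = z;
  twistedE : forall x n, X x -> f (translate (phi n) x) = translate n (f x) }.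

Lemma twisted_at f x n : twisted f -> X x -> f x n = f (translate (phi n) x) 0.
Proof. by move=> tf Xx; rewrite twistedE // /translate addr0. Qed.

Lemma twisted_local f w c (F : {fset site}) : twisted f -> window f w c ->
  exists F' : {fset site}, forall x y, X x -> X y ->
    (forall m, m \in F' -> x m = y m) -> forall m, m \in F -> f x m = f y m.
Proof.
move=> tf wf; have [R hR] := small_fset l w.
exists (\bigcup_(n <- F) [fset (phi n + (c + u))%R | u in R])%fset => x y Xx Xy xy m mF.
rewrite !(twisted_at m tf) //; apply: wf; try exact: hull_translate.
move=> u su; apply: xy; apply/bigfcupP; exists m; first by rewrite mF.
by apply/imfsetP; exists u => //; exact: hR.
Qed.

(* The class is locally constant, and invariant under the shifts by multiples of
   [L], under which every [csub y] has a dense orbit among all [csub z]. *)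
Lemma image_same_class f w c (a : A) : twisted f -> window f w c ->
  exists r, forall y, X y -> exists2 z, X z & f (csub y) = translate r (csub z).
Proof.
move=> tf wf; have [y0 Xy0] := hull_nonempty a.
have [r [z0 [Xz0 fy0]]] := hull_desubst (twisted_hull tf (hull_csub Xy0)).
exists r => y Xy; have [F hF] := hull_class_local Xz0 fy0.
have [F1 hF1] := twisted_local F tf wf.
have [n hn] := hull_minimal [fset cell m | m in F1]%fset Xy Xy0.
have Xny := hull_translate n Xy.
have [|z Xz fE] := hF _ (twisted_hull tf (hull_csub Xny)).
  apply: hF1 => [||m mF1]; try exact: hull_csub.
  by rewrite /csub hn //; apply/imfsetP; exists m.
exists (translate (- psi n) z); first exact: hull_translate.
apply: (@translate_inj (psi n *+ L)).
rewrite -(twistedE tf) ?phiMn ?psiK -?csub_translate ?fE //; last exact: hull_csub.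
by rewrite csub_translate !translateD mulNrn addrCA addNr addr0.
Qed.

(** All images of inflated points lie on one grid, so [f1 y] is the desubstitution of
    [f (csub y)]. *)
Lemma renormalize f w c (a : A) : twisted f -> window f w c ->
  exists r f1, twisted f1 /\
    forall y, X y -> f (csub y) = translate r (csub (f1 y)).
Proof.
move=> tf wf; have [r hr] := image_same_class a tf wf.
pose f1 (y : config) : config := fun m => f (csub y) (m *+ L - r).
have f1E y z : f (csub y) = translate r (csub z) -> f1 y = z.
  by move=> fy; apply/funext => m; rewrite /f1 fy /translate addrC subrK csub_scale.
have f1P y : X y -> f (csub y) = translate r (csub (f1 y)).
  by move=> /hr[z _ fy]; rewrite (f1E _ _ fy).
exists r, f1; split=> //; split.
- by move=> y /hr[z Xz /f1E ->].
(* Surjectivity: a preimage of the inflated [z] is a translate of some [csub y], and recognizability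
   makes [z] a translate of [f1 y]. *)
- move=> z Xz; have [x Xx fx] := twisted_onto tf (hull_translate r (hull_csub Xz)).
  have [n [y [Xy xE]]] := hull_desubst Xx.
  have [z' Xz' fy] := hr _ Xy.
  have := fx; rewrite xE -[n]psiK (twistedE tf) ?fy; last exact: hull_csub.
  rewrite translateD addrC -translateD => /translate_inj/esym.
  move=> /(recognizable Xz Xz')[k _ ->].
  exists (translate (phi k) y); first exact: hull_translate.
  apply: f1E; rewrite !csub_translate -phiMn (twistedE tf) ?fy; last exact: hull_csub.
  by rewrite !translateD addrC.
- move=> y n Xy; apply: f1E; rewrite !csub_translate -phiMn (twistedE tf); last exact: hull_csub.
  by rewrite f1P // !translateD addrC.
Qed.

(* [f1 y 0] is read at the site [s] of its cell, for which the window of [f] is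
   centered at the center [d *+ L] of a cell of [csub y]. *)
Lemma renormalize_window f f1 r w c s d : twisted f -> window f w c ->
    (forall y, X y -> f (csub y) = translate r (csub (f1 y))) ->
    small N s -> phi (s - r) + c = d *+ L ->
  window f1 ((w + N) %/ L) d.
Proof.
move=> tf wf f1P ss sd x y Xx Xy xy; apply: (can_inj (actK (th s))).
have E z : X z -> act (th s) (f1 z 0) = f (translate (phi (s - r)) (csub z)) 0.
  move=> Xz; rewrite -twisted_at //; last exact: hull_csub.
  by rewrite f1P // /translate addrC subrK csub_small0.
rewrite !E //; apply: wf; try exact/hull_translate/hull_csub.
move=> u su; rewrite /translate addrA sd /csub cell_scaleD offset_scaleD.
by rewrite xy //; exact: small_cell.
Qed.

(** The site [r - psi c] solves the equation with [d = 0]; reducing it into the cell changes the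
    left side by a multiple of [L]. *)
Lemma centered_offset r c : exists s d, small N s /\ phi (s - r) + c = d *+ L.
Proof.
exists (offset (r - psi c)), (- phi (cell (r - psi c))); split.
  exact: small_offset.
have -> : offset (r - psi c) - r = - (psi c + cell (r - psi c) *+ L).
  by apply/rowP => i; rewrite !siteE; lia.
by rewrite phiN phiD phiMn psiK mulNrn opprD addrAC addNr add0r.
Qed.

(** Every letter occurs at [c], so [tau] is defined on all of [A]; [f] being onto makes [tau] onto,
    hence injective. *)
Lemma window0_relabelling f c (a0 : A) : twisted f -> window f 0 c ->
  exists2 tau : A -> A, injective tau & forall x, X x -> forall n, f x n = tau (x (phi n + c)).
Proof.
move=> tf wf; have [x0 Xx0] := hull_nonempty a0.
have /choice[tau tauP] a : exists b, forall x, X x -> x c = a -> f x 0 = b.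
  have [z Xz za] := hull_letter c a Xx0; exists (f z 0) => x Xx xa.
  apply: wf => // u su; suff -> : u = 0 by rewrite addr0 xa.
  by apply/rowP => i; have := su i; rewrite zeroE; lia.
have tauE x n : X x -> f x n = tau (x (phi n + c)).
  move=> Xx; rewrite (twisted_at n tf Xx).
  by apply: tauP => //; exact: hull_translate.
exists tau => [|x Xx n]; last exact: tauE.
apply: onto_inj => b; have [z Xz <-] := hull_letter 0 b Xx0.
by have [x Xx <-] := twisted_onto tf Xz; exists (x (phi 0 + c)); rewrite tauE.
Qed.

Section BasePoint.
Variables (f f1 : config -> config) (r c d s0 : site) (tau tau1 : A -> A) (a0 : A).
Hypotheses (tau_inj : injective tau) (tau1_inj : injective tau1).
Hypothesis fE : forall x, X x -> forall n, f x n = tau (x (phi n + c)).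
Hypothesis f1E : forall x, X x -> forall n, f1 x n = tau1 (x (phi n + d)).
Hypothesis f1P : forall y, X y -> f (csub y) = translate r (csub (f1 y)).
Hypothesis s0d : phi (s0 - r) + c = d *+ L.

(** Both sides compute [f (csub y)] at [s - r], directly and through [f1]. *)
Lemma columnE y s : X y -> small N s ->
  tau (csub y (d *+ L + phi (s - s0))) = act (th s) (tau1 (y d)).
Proof.
move=> Xy ss; have := congr1 (fun g => g (s - r)) (f1P Xy).
rewrite fE; last exact: hull_csub.
rewrite /translate [r + _]addrC subrK (csub_small0 (f1 y) ss) f1E // phi0 add0r => <-.
congr (tau (csub _ _)); rewrite -s0d addrAC -phiD; congr (phi _ + _).
by apply/rowP => i; rewrite !siteE; lia.
Qed.

(* Otherwise the column at [s] would express a letter of [y] at some site other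
   than [d] as a function of the letter at [d]. *)
Lemma phi_box s : small N s -> small N (phi (s - s0)).
Proof.
move=> ss; set v := phi _; suff v0 : cell v = 0.
  by rewrite (cell_offset N v) v0 mul0rn add0r; exact: small_offset.
have [k k1 k2] := injF_bij tau_inj; have [k' k1' k2'] := injF_bij tau1_inj.
apply: (@letter_independence
  (fun a => act (th (offset v))^-1%g (k (act (th s) (tau1 a)))) d) => //.
  move=> b; exists (k' (act (th s)^-1%g (tau (act (th (offset v)) b)))).
  by rewrite k2' actKV k1 actK.
by move=> y Xy; rewrite -columnE // k1 /csub cell_scaleD offset_scaleD actK.
Qed.

(** By [phi_box], [v] lies in the cell with index [phi (cell m)]; this index is 0 and [phi] is
    injective. *)
Lemma psi_box v : small N v -> small N (psi v + s0).
Proof.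
move=> sv; set m := psi v + s0.
have := phi_box (small_offset N m).
have -> : offset m - s0 = psi v - cell m *+ L.
  by apply/rowP => i; rewrite /m !siteE; lia.
rewrite phiD phiN psiK phiMn => su.
have : cell v = phi (cell m).
  rewrite -[v](subrK (phi (cell m) *+ L)) addrC cell_scaleD (cell_small su).
  by rewrite addr0.
rewrite cell_small // -phi0 => /(can_inj phiK) m0.
by rewrite (cell_offset N m) -m0 mul0rn add0r; exact: small_offset.
Qed.

(** The two inclusions and negation make the cube symmetric about [s0]; opposite vertices then force
    [s0 = 0]. *)
Lemma central_offset_eq0 : s0 = 0.
Proof.
have box s : small N s -> small N (s0 - s + s0).
  by move=> /phi_box/smallN/psi_box; rewrite -phiN phiK opprB.
apply/rowP => i; rewrite zeroE.
have h (e : int) : - 1 <= e <= 1 -> - N%:Z <= s0 0 i *+ 2 - e * N%:Z <= N%:Z.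
  move=> he; pose v : site := \row_j (e * N%:Z).
  have vE j : v 0 j = e * N%:Z by exact: mxE.
  have sv : small N v by move=> j; rewrite vE; nia.
  by have := box v sv i; rewrite !siteE vE; lia.
by have := h 1 isT; have := h (- 1) isT; lia.
Qed.

End BasePoint.

Lemma phi_coord s i : phi s 0 i = \sum_j phi (unit_site j) 0 i * s 0 j.
Proof.
have {1}-> : s = \sum_j unit_site j *~ s 0 j.
  apply/rowP => k; rewrite summxE (bigD1 k) //= big1 => [|j jk]; rewrite scalezE unit_siteE.
    by rewrite eqxx mul1r addr0.
  by rewrite eq_sym (negPf jk) mul0r.
rewrite (big_morph phi phiD phi0) summxE.
by apply: eq_bigr => j _; rewrite phiMz scalezE.
Qed.

Lemma box_signed_perm : (forall s, small N s -> small N (phi s)) ->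
  exists (eps : 'I_l -> int) (pi : 'I_l -> 'I_l),
    (forall i, - 1 <= eps i <= 1) /\ forall s, phi s = signed_site eps pi s.
Proof.
move=> box.
suff /choice[h hP] i : exists ej : int * 'I_l, - 1 <= ej.1 <= 1 /\
    forall s, phi s 0 i = ej.1 * s 0 ej.2.
  exists (fun i => (h i).1), (fun i => (h i).2); split=> [i|s]; first by case: (hP i).
  by apply/rowP => i; rewrite [RHS]mxE; case: (hP i).
pose M j := phi (unit_site j) 0 i.
have M1 j : - 1 <= M j <= 1.
  have /box/(_ i) : small N (unit_site j *+ N).
    by move=> k; rewrite !siteE unit_siteE; case: (k == j); lia.
  by rewrite phiMn scaleE -/(M j); nia.
(* Two nonzero coefficients in the same row send a vertex outside the cube. *)
have M0 j k : j != k -> M j != 0 -> M k = 0.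
  move=> jk; have /box/(_ i) : small N ((unit_site j *~ M j + unit_site k *~ M k) *+ N).
    move=> q; rewrite !siteE.
    rewrite !unit_siteE; have Mj := M1 j; have Mk := M1 k.
    have [->|_] := q =P j; first by rewrite (negPf jk) mul0r addr0 mul1r; nia.
    by rewrite mul0r add0r; case: (q == k); rewrite ?mul0r ?mul1r; nia.
  rewrite phiMn phiD !phiMz !siteE.
  rewrite -/(M j) -/(M k); have Mj := M1 j; have Mk := M1 k => h Mj0.
  have MjE : M j = 1 \/ M j = -1 by lia.
  have MkE : M k = 0 \/ M k = 1 \/ M k = -1 by lia.
  by case: MjE MkE h => [->|->] [->|[->|->]]; lia.
have [[j Mj]|none] := pselect (exists j, M j != 0).
  exists (M j, j); split=> [|s]; first exact: M1.
  rewrite /= phi_coord (bigD1 j) //= big1 ?addr0 //.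
  by move=> k kj; rewrite -/(M k) (M0 j) ?mul0r // eq_sym.
(* A zero row gets coefficient 0 and an arbitrary index. *)
exists (0, i); split=> // s; rewrite phi_coord big1 ?mul0r // => k _.
rewrite -/(M k); have [->|Mk] := eqVneq (M k) 0; first by rewrite mul0r.
by case: none; exists k.
Qed.

Definition normal_form (f : config -> config) := exists p tau n,
  [/\ phi =1 psite p, equivariant tau &
      forall x, X x -> f x = fun m => tau (x (psite p m + n))].

(** A one-point window stays one under renormalization, so [f1] has a letter map [tau1] too.
    Relation [colE] gives [tau1 = tau] at [s = 0], then that [phi] preserves the identity columns,
    then equivariance. *)
Lemma normal_form0 f c (a0 : A) : twisted f -> window f 0 c -> normal_form f.
Proof.
move=> tf wf; have [r [f1 [tf1 f1P]]] := renormalize a0 tf wf.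
have [s0 [d [ss0 s0d]]] := centered_offset r c.
have wf1 : window f1 0 d.
  suff <- : ((0 + N) %/ L)%N = 0%N by exact: renormalize_window tf wf f1P ss0 s0d.
  by rewrite divn_small //; lia.
have [tau tau_inj fE] := window0_relabelling a0 tf wf.
have [tau1 tau1_inj f1E] := window0_relabelling a0 tf1 wf1.
have s00 := central_offset_eq0 a0 tau_inj tau1_inj fE f1E f1P s0d.
have col := columnE fE f1E f1P s0d; have box := phi_box a0 tau_inj tau1_inj fE f1E f1P s0d.
rewrite s00 in col box.
have {}box s : small N s -> small N (phi s) by move=> /box; rewrite subr0.
have [x0 Xx0] := hull_nonempty a0.
have letter_at a : exists2 y, X y & y d = a by exact: hull_letter Xx0.
have colE s a : small N s -> tau (act (th (phi s)) a) = act (th s) (tau1 a).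
  move=> ss; have [y Xy <-] := letter_at a.
  by rewrite -col // subr0 csub_small //; exact: box.
have tau1E a : tau1 a = tau a.
  by rewrite -[LHS]act1 -th0 -colE ?phi0 ?th0 ?act1 //; exact: small0.
have [eps [pi [eps1 phiE]]] := box_signed_perm box.
have [p hp] : exists p, forall u, signed_site eps pi u = psite p u.
  apply: th_rigid => // u su; rewrite -phiE; split=> thu; apply: act_faithful => a.
    have [k k1 k2] := injF_bij tau_inj.
    by have := colE u (k a) su; rewrite thu act1 tau1E k2 => <-.
  by apply: tau_inj; rewrite colE // thu act1 tau1E.
have phi_p u : phi u = psite p u by rewrite phiE hp.
exists p, tau, c; split=> // [g a|x Xx].
  by have [u su <-] := th_onto g; have := colE u a su; rewrite phi_p th_psite tau1E.
by apply/funext => m; rewrite fE // phi_p.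
Qed.

Lemma twisted_normal_form f w c (a0 : A) : twisted f -> window f w c -> normal_form f.
Proof.
elim/ltn_ind: w f c => w IH f c tf wf.
have [w0|w0] := posnP w; first by apply: (normal_form0 (c := c)) => //; rewrite -w0.
have [r [f1 [tf1 f1P]]] := renormalize a0 tf wf.
have [s [d [ss sd]]] := centered_offset r c.
have [p [tau [n [phi_p tau_eq f1E]]]] :=
  IH _ (shrunk_window_lt w0) f1 d tf1 (renormalize_window tf wf f1P ss sd).
exists p, tau, (psite p r + n *+ L); split=> // x /hull_desubst[k [y [Xy ->]]].
rewrite -[k]psiK twistedE //; last exact: hull_csub.
rewrite f1P // f1E // (csub_equivariant p n y tau_eq).
apply/funext => m; rewrite /translate psiK; congr (tau (csub y _)).
by rewrite -!phi_p !phiD psiK; apply/rowP => i; rewrite !siteE; lia.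
Qed.

End Normaliser.

(** * The symmetry groups *)

Variables (H : finGroupType) (hact : H -> A -> A).
Hypothesis pact1 : forall i, pact 1%g i = i.
Hypothesis pactM : forall p q i, pact (p * q)%g i = pact p (pact q i).
Hypothesis pact_faithful : forall p, (forall i, pact p i = i) -> p = 1%g.
Hypothesis hact1 : forall a, hact 1%g a = a.
Hypothesis hactM : forall h k a, hact (h * k)%g a = hact h (hact k a).
Hypothesis hact_free : forall h a, hact h a = a -> h = 1%g.
Hypothesis hact_equivariant : forall h, equivariant (hact h).
Hypothesis equivariant_hact : forall tau, equivariant tau -> exists h, tau =1 hact h.
Variable a0 : A.

Local Notation shifts := (@shift_group _ _ col_subst).

Local Notation psiteM := (psiteM pactM).
Local Notation psite1 := (psite1 pact1).
Local Notation psiteK := (psiteK pact1 pactM).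
Local Notation psiteVK := (psiteVK pact1 pactM).

(** The shift by [n] is applied last, so that these maps compose by the semidirect product law. *)
Definition sym_config n h p (x : config) : config :=
  fun m => hact h (x (psite p (n + m))).

Lemma csuper_sym h p k a m :
  csuper k (hact h a) m = omap (hact h) (csuper k a (psite p m)).
Proof.
elim: k m => [|k IH] m.
  rewrite /= /letter -{2}(psite0 pact p) (can_eq (psiteK p)).
  by case: (m == 0).
rewrite !csuperS IH offset_psite cell_psite th_psite.
by case: csuper => //= b; rewrite hact_equivariant.
Qed.

Lemma hull_sym n h p x : X x -> X (sym_config n h p x).
Proof.
move=> /hullP hx; apply/hullP => F.
have [k [a [t ht]]] := hx [fset psite p (n + m) | m in F]%fset.
exists k, (hact h a), (psite p^-1%g t + n) => m mF.
rewrite (csuper_sym h p) -addrA psiteD psiteVK ht //.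
by apply/imfsetP; exists m.
Qed.

Lemma sym_configM n h p n' h' p' x :
  sym_config n h p (sym_config n' h' p' x) =
  sym_config (n + psite p^-1%g n') (h * h')%g (p * p')%g x.
Proof.
apply/funext => m; rewrite /sym_config hactM -[in RHS]psiteM.
congr (hact h (hact h' (x (psite p' _)))).
by rewrite !psiteD psiteVK addrCA addrA.
Qed.

Lemma sym_config1 n x : sym_config n 1%g 1%g x = translate n x.
Proof. by apply/funext => m; rewrite /sym_config hact1 psite1. Qed.

Definition sym_map n h p (x : X) : X :=
  exist _ (sym_config n h p (\val x)) (mem_set (hull_sym n h p (set_mem (valP x)))).

Lemma sym_map_continuous n h p : continuous (sym_map n h p).
Proof. exact: (@relabel_continuous _ _ _ (hact h) (fun m => psite p (n + m))). Qed.

Lemma sym_mapK n h p :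
  cancel (sym_map n h p) (sym_map (- psite p n) h^-1%g p^-1%g).
Proof.
move=> x; apply: val_inj; rewrite /= sym_configM invgK addNr !mulVg.
by rewrite sym_config1 translate0.
Qed.

Lemma sym_mapVK n h p :
  cancel (sym_map (- psite p n) h^-1%g p^-1%g) (sym_map n h p).
Proof.
move=> x; apply: val_inj; rewrite /= sym_configM psiteN psiteK subrr !mulgV.
by rewrite sym_config1 translate0.
Qed.

Definition sym_homeo n h p : homeo X :=
  Homeo (@sym_map_continuous n h p) (@sym_map_continuous _ _ _)
    (sym_mapK n h p) (sym_mapVK n h p).

Lemma sym_homeoM n h p n' h' p' :
  (sym_homeo n h p * sym_homeo n' h' p')%g =
  sym_homeo (n + psite p^-1%g n') (h * h')%g (p * p')%g.
Proof. by apply: homeoP => x; apply: val_inj; exact: sym_configM. Qed.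

Lemma shift_homeoE n : shift_homeo col_subst n = sym_homeo n 1%g 1%g.
Proof. by apply: homeoP => x; apply: val_inj; rewrite /= sym_config1. Qed.

(** For the identity map, the letter at [m] determines the one at [psite p (n + m)]; by letter
    independence the two sites coincide. *)
Lemma sym_homeo_trivial n h p : sym_homeo n h p = 1%g -> [/\ n = 0, h = 1%g & p = 1%g].
Proof.
move=> e; have sE x : X x -> sym_config n h p x = x.
  move=> Xx; pose x' : X := exist _ x (mem_set Xx).
  by have := congr1 (fun g : homeo X => \val (g x')) e.
have pE m : psite p (n + m) = m.
  apply/eqP; rewrite -subr_eq0; apply/eqP.
  apply: (@letter_independence (hact h^-1%g) m) a0 => [b|x Xx].
    by exists (hact h b); rewrite -hactM mulVg hact1.
  by rewrite addrC subrK -{2}(sE x Xx) -hactM mulVg hact1.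
have n0 : n = 0.
  by have := pE (- n); rewrite subrr psite0 => /esym/eqP; rewrite oppr_eq0 => /eqP.
have p1 : p = 1%g.
  apply: pact_faithful => i; have := congr1 (fun u : site => u 0 i) (pE (unit_site i)).
  by rewrite n0 add0r psiteE !unit_siteE eqxx; case: eqP.
have [x Xx] := hull_nonempty a0.
split=> //; apply: (@hact_free h (x 0)).
by have := congr1 (fun y => y 0) (sE x Xx); rewrite /sym_config n0 p1 psite1 addr0.
Qed.

Lemma shift_homeo_conj n h p m :
  (shift_homeo col_subst m ^ sym_homeo n h p)%g = shift_homeo col_subst (psite p m).
Proof.
have e : (shift_homeo col_subst m * sym_homeo n h p)%g =
    (sym_homeo n h p * shift_homeo col_subst (psite p m))%g.
  by rewrite !shift_homeoE !sym_homeoM psiteK invg1 psite1 !mul1g !mulg1 addrC.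
by rewrite /conjg e mulKg.
Qed.

Lemma sym_homeo_normal n h p : sym_homeo n h p \in normaliser_of shifts.
Proof.
apply/mem_set; rewrite /normaliser_of /= eqEsubset; split=> g.
  by case=> _ [m _ <-] <-; rewrite shift_homeo_conj; exists (psite p m).
case=> m _ <-; exists (shift_homeo col_subst (psite p^-1%g m)); first by exists (psite p^-1%g m).
by rewrite shift_homeo_conj psiteVK.
Qed.

Lemma shift_homeoD m n :
  shift_homeo col_subst (m + n) = (shift_homeo col_subst m * shift_homeo col_subst n)%g.
Proof. by rewrite !shift_homeoE sym_homeoM invg1 psite1 !mul1g. Qed.

Lemma shift_homeo_inj : injective (shift_homeo col_subst).
Proof.
move=> m n e; have : shift_homeo col_subst (m - n) = 1%g.
  rewrite shift_homeoD e -shift_homeoD subrr shift_homeoE.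
  by apply: homeoP => x; apply: val_inj; rewrite /= sym_config1 translate0.
by rewrite shift_homeoE => /sym_homeo_trivial[/eqP]; rewrite subr_eq0 => /eqP.
Qed.

Lemma normal_sym_homeo g : g \in normaliser_of shifts ->
  exists n h p, g = sym_homeo n h p.
Proof.
move=> /set_mem gN; rewrite /normaliser_of /= in gN.
(* As [a ^ g] is [g^-1 * a * g], the map [g] turns the shift by [phi n] into the shift by [n]. *)
have /choice[phi phiE] n : exists m, (shift_homeo col_subst n ^ g)%g = shift_homeo col_subst m.
  have : shifts (shift_homeo col_subst n ^ g)%g.
    by rewrite -gN; exists (shift_homeo col_subst n) => //; exists n.
  by case=> m _ <-; exists m.
have /choice[psi psiE] m : exists n, phi n = m.
  have : shifts (shift_homeo col_subst m) by exists m.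
  rewrite -gN => -[_ [n _ <-]]; rewrite phiE => e; exists n; exact: shift_homeo_inj e.
have phiD : {morph phi : m n / m + n}.
  by move=> m n; apply: shift_homeo_inj; rewrite -phiE !shift_homeoD conjMg !phiE.
have phi_inj : injective phi.
  move=> m n e; apply: shift_homeo_inj; apply: (conjg_inj g); by rewrite !phiE e.
have phiK : cancel phi psi by move=> n; apply: phi_inj; rewrite psiE.
(* [g] is extended by the identity outside the hull, where [twisted] and [window] demand nothing. *)
pose f (x : config) : config :=
  if pselect (X x) is left Xx then \val (g (exist _ x (mem_set Xx))) else x.
have fE (x : X) : f (\val x) = \val (g x).
  rewrite /f; case: pselect => [Xx|]; last by case; exact/set_mem/valP.
  by congr (\val (g _)); apply: val_inj.
have lift x : X x -> exists y : X, \val y = x by move=> Xx; exists (exist _ x (mem_set Xx)).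
have gK (x : X) : g ((g^-1)%g x) = x by exact: homeoVK.
have tf : twisted phi f.
  split.
  - by move=> _ /lift[x <-]; rewrite fE; exact/set_mem/valP.
  - move=> _ /lift[z <-]; exists (\val ((g^-1)%g z)); last by rewrite fE gK.
    exact/set_mem/valP.
  - move=> _ n /lift[x <-].
    have -> : translate (phi n) (\val x) = \val (shift_homeo col_subst (phi n) x) by [].
    rewrite !fE -phiE.
    have -> : g ((shift_homeo col_subst n ^ g)%g x) = shift_homeo col_subst n (g x).
      by rewrite /conjg /=; exact: gK.
    by [].
have [w gw] := continuous_window (@homeo_cts _ g).
have wf : window f w 0.
  move=> _ _ /lift[x <-] /lift[y <-] xy; rewrite !fE; apply: gw => u su.
  by have := xy u su; rewrite add0r.
have [p [tau [n [phi_p tau_eq fn]]]] := twisted_normal_form phiD phiK psiE a0 tf wf.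
have [h tauE] := equivariant_hact tau_eq.
exists (psite p^-1%g n), h, p; apply: homeoP => x; apply: val_inj.
rewrite -fE fn; last exact/set_mem/valP.
by apply/funext => m; rewrite /= /sym_config -tauE psiteD psiteVK addrC.
Qed.

Local Notation kernel_type := (Algebra.to_multiplicative site * H)%type.

(** The inverse turns the right action [psite] into a left one. *)
Definition coord_act (p : P) (u : kernel_type) : kernel_type :=
  (psite p^-1%g u.1, u.2).

Lemma coord_actM p : {morph coord_act p : u v / (u * v)%g}.
Proof. by move=> u v; congr (_, _); exact: psiteD. Qed.

Lemma coord_act1 u : coord_act 1%g u = u.
Proof. by case: u => n h; rewrite /coord_act invg1 psite1. Qed.

Lemma coord_act_comp p q u : coord_act (p * q)%g u = coord_act p (coord_act q u).
Proof. by rewrite /coord_act /= psiteM invMg. Qed.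

Definition coord_action := GautAction coord_actM coord_act1 coord_act_comp.

Lemma extended_symmetry_iso :
  isomorphic (extended_symmetry_group col_subst) (sdprod_type coord_action).
Proof.
pose F (u : sdprod_type coord_action) : extended_symmetry_group col_subst :=
  exist _ (sym_homeo u.1.1 u.1.2 u.2) (sym_homeo_normal _ _ _).
apply: (@isomorphic_of_inverse _ _ F).
- by move=> u v; apply: val_inj; rewrite /= sym_homeoM.
- move=> [[n h] p] /(congr1 val) /= /sym_homeo_trivial[n0 h1 p1].
  by rewrite n0 h1 p1.
- move=> [g gN]; have [n [h [p gE]]] := normal_sym_homeo gN.
  by exists ((n, h), p); apply: val_inj.
Qed.

Lemma sym_homeo_central n h : sym_homeo n h 1%g \in centraliser_of shifts.
Proof.
apply/mem_set => _ [m _ <-].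
by rewrite /commute shift_homeoE !sym_homeoM invg1 !psite1 !mul1g !mulg1 addrC.
Qed.

(** A central element normalises the shifts, so it has a normal form, and its [p] must fix every
    unit site. *)
Lemma central_sym_homeo g : g \in centraliser_of shifts ->
  exists n h, g = sym_homeo n h 1%g.
Proof.
move=> /set_mem gC.
have cg a : shifts a -> (a ^ g)%g = a.
  by move=> /gC ga; rewrite /conjg -ga mulKg.
have [|n [h [p gE]]] := @normal_sym_homeo g.
  apply/mem_set; rewrite /normaliser_of /= eqEsubset; split=> a.
    by case=> b sb <-; rewrite cg.
  by move=> sa; exists a => //; exact: cg.
exists n, h; rewrite gE; congr sym_homeo; apply: pact_faithful => i.
have : shift_homeo col_subst (psite p (unit_site i)) = shift_homeo col_subst (unit_site i).
  by rewrite -(shift_homeo_conj n h) -gE cg //; exists (unit_site i).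
move=> /shift_homeo_inj/(congr1 (fun u : site => u 0 i)).
by rewrite psiteE !unit_siteE eqxx; case: eqP.
Qed.

Lemma symmetry_iso : isomorphic (symmetry_group col_subst) kernel_type.
Proof.
pose F (u : kernel_type) : symmetry_group col_subst :=
  exist _ (sym_homeo u.1 u.2 1%g) (sym_homeo_central _ _).
apply: (@isomorphic_of_inverse _ _ F).
- by move=> u v; apply: val_inj; rewrite /= sym_homeoM invg1 psite1 mulg1.
- by move=> [n h] /(congr1 val) /= /sym_homeo_trivial[-> -> _].
- move=> [g gN]; have [n [h gE]] := central_sym_homeo gN.
  by exists (n, h); apply: val_inj.
Qed.

End ColumnSubstitution.

(** * The columns and the letters *)

Section Marks.
Variables (l : nat) (G P : finGroupType) (pact : P -> 'I_l -> 'I_l).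
Hypothesis l_gt0 : (0 < l)%N.
Hypothesis pact1 : forall i, pact 1%g i = i.
Hypothesis pactM : forall p q i, pact (p * q)%g i = pact p (pact q i).
Notation site := 'rV[int]_l.
Notation psite := (psite pact).

(* A multiple of [#|G|], so that [g ^+ N = 1], which exceeds all the numbers
   [l * enum_rank g + i] with [i < l]. *)
Definition radius : nat := (l * #|G|)%N.
Notation N := radius.

(* The coordinates of such a site are negative, which excludes sign changes, and
   are distinct modulo [l], which makes the permutation [p] readable. *)
Definition mark (g : G) (p : P) (u : site) :=
  [forall i, u 0%R i + N%:Z == (l * enum_rank g + pact p i)%N%:Z].

Definition mark_col (u : site) : G := odflt 1%g [pick g | [exists p, mark g p u]].

Lemma markP g p (u : site) :
  reflect (forall i, u 0 i + N%:Z = (l * enum_rank g + pact p i)%N%:Z) (mark g p u).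
Proof. by apply: (iffP forallP) => h i; apply/eqP. Qed.

Lemma mark_range (g : G) (i : 'I_l) : (l * enum_rank g + i < N)%N.
Proof.
rewrite (@leq_trans (l * (enum_rank g).+1)) //; first by rewrite mulnSr ltn_add2l.
by rewrite leq_mul2l ltn_ord orbT.
Qed.

Lemma mark_uniq (g g' : G) (i i' : 'I_l) :
  (l * enum_rank g + i)%N%:Z = (l * enum_rank g' + i')%N%:Z -> g = g' /\ i = i'.
Proof.
move=> [e]; have r := congr1 (divn^~ l) e; have m := congr1 (modn^~ l) e.
move: r m; rewrite /= ![(l * _)%N]mulnC !divnMDl // !modnMDl.
rewrite !(divn_small (ltn_ord _)) !(modn_small (ltn_ord _)) !addn0.
by move=> /ord_inj/enum_rank_inj -> /ord_inj.
Qed.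

Lemma mark_col_mark g p u : mark g p u -> mark_col u = g.
Proof.
move=> gu; rewrite /mark_col; case: pickP => [g'|/(_ g)].
  move=> /= /existsP[p' /markP gu']; have {}gu := markP _ _ _ gu.
  by case: (mark_uniq (etrans (esym (gu' (Ordinal l_gt0))) (gu (Ordinal l_gt0)))).
by move=> /= /negbT/existsPn/(_ p); rewrite gu.
Qed.

Lemma mark_col_neq1 u : mark_col u <> 1%g -> exists g p, mark g p u.
Proof. by rewrite /mark_col; case: pickP => // g /= /existsP[p gu] _; exists g, p. Qed.

Lemma mark_lt0 g p (u : site) i : mark g p u -> u 0 i < 0.
Proof. by move=> /markP/(_ i); have := mark_range g (pact p i); lia. Qed.

Lemma mark_col_nonneg (u : site) i : 0 <= u 0 i -> mark_col u = 1%g.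
Proof.
by move=> ui; apply: contrapT => /mark_col_neq1[g [p /(mark_lt0 i)]]; lia.
Qed.

Lemma mark_col0 : mark_col 0 = 1%g.
Proof. by apply: (@mark_col_nonneg _ (Ordinal l_gt0)); rewrite zeroE. Qed.

Definition mark_site (g : G) : site := \row_i ((l * enum_rank g + i)%N%:Z - N%:Z).

Lemma mark_siteE g i : mark_site g 0 i = (l * enum_rank g + i)%N%:Z - N%:Z.
Proof. exact: mxE. Qed.

Lemma mark_site_mark g : mark g 1%g (mark_site g).
Proof. by apply/markP => i; rewrite mark_siteE pact1 subrK. Qed.

Lemma small_mark_site g : small N (mark_site g).
Proof. by move=> i; rewrite mark_siteE; have := mark_range g i; lia. Qed.

(** Adding [N] to one coordinate of a marked site makes it nonnegative, which no marked site
    allows. *)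
Lemma mark_col_line g i : exists u, [/\ small N u,
  small N (u + unit_site i *+ N), mark_col u = g & mark_col (u + unit_site i *+ N) = 1%g].
Proof.
have uE j : (mark_site g + unit_site i *+ N) 0 j =
    (l * enum_rank g + j)%N%:Z - (if j == i then 0 else N)%:Z.
  by rewrite !siteE mark_siteE unit_siteE; case: (j == i) => /=; lia.
exists (mark_site g); split; first exact: small_mark_site.
- by move=> j; rewrite uE; have := mark_range g j; case: (j == i); lia.
- exact/mark_col_mark/mark_site_mark.
- by apply: (@mark_col_nonneg _ i); rewrite uE eqxx; lia.
Qed.

Lemma mark_col_onto g : exists2 u, small N u & mark_col u = g.
Proof.
by exists (mark_site g); [exact: small_mark_site | exact/mark_col_mark/mark_site_mark].
Qed.

Lemma mark_psite g p q u : mark g p u -> mark g (p * q)%g (psite q u).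
Proof. by move=> /markP h; apply/markP => i; rewrite psiteE h pactM. Qed.

Lemma mark_col_psite p u : mark_col (psite p u) = mark_col u.
Proof.
have [[g [q gu]]|none] := pselect (exists g q, mark g q u).
  by rewrite (mark_col_mark gu) (mark_col_mark (mark_psite p gu)).
have [u1|/mark_col_neq1//] := pselect (mark_col u = 1%g).
rewrite u1; apply: contrapT => /mark_col_neq1[g [q gu]]; case: none.
by exists g, (q * p^-1)%g; have := mark_psite p^-1%g gu; rewrite psiteK.
Qed.

(** One marked site with [g <> 1] suffices: its image is marked, so negative coordinates force
    [eps i = 1], and residues modulo [l] then give [pi]. *)
Lemma mark_col_rigid (eps : 'I_l -> int) (pi : 'I_l -> 'I_l) : (1 < #|G|)%N ->
    (forall i, - 1 <= eps i <= 1) ->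
    (forall u, small N u -> mark_col (signed_site eps pi u) = 1%g <-> mark_col u = 1%g) ->
  exists p, forall u, signed_site eps pi u = psite p u.
Proof.
move=> G1 eps1 fixS.
have [g g1] : exists g : G, g <> 1%g.
  have /card_gt1P[x [y [_ _ xy]]] := G1.
  have [x1|x1] := pselect (x = 1%g); last by exists x.
  by exists y => y1; rewrite x1 y1 eqxx in xy.
have /mark_col_neq1[g' [p /markP gu]] : mark_col (signed_site eps pi (mark_site g)) <> 1%g.
  rewrite fixS; first by rewrite (mark_col_mark (mark_site_mark g)).
  exact: small_mark_site.
have epi i : eps i = 1 /\ pi i = pact p i.
  have := gu i; rewrite [signed_site _ _ _ 0 i]mxE mark_siteE => e.
  have r := mark_range g (pi i); have r' := mark_range g' (pact p i).
  have e1 : eps i = 1 by have := eps1 i; nia.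
  by rewrite e1 mul1r subrK in e; have [] := mark_uniq e.
exists p => u; apply/rowP => i; rewrite psiteE [LHS]mxE.
by have [-> ->] := epi i; rewrite mul1r.
Qed.

End Marks.

(** * The letters and the centraliser of the columns *)

Section Letters.
Variable H : finGroupType.
Notation letters := (H * 'I_3)%type.
Notation cols := (H * 'S_3)%type.
Local Open Scope group_scope.

(** Permutations compose from left to right, so the inverse makes this a left action. *)
Definition col_act (g : cols) (a : letters) : letters := (g.1 * a.1, g.2^-1 a.2).
Definition fiber_act (h : H) (a : letters) : letters := (a.1 * h^-1, a.2).

Lemma col_act1 a : col_act 1 a = a.
Proof. by case: a => x b; rewrite /col_act /= mul1g invg1 perm1. Qed.

Lemma col_actM g h a : col_act (g * h) a = col_act g (col_act h a).
Proof. by rewrite /col_act /= invMg permM mulgA. Qed.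

Lemma col_act_trans a b : exists g, col_act g a = b.
Proof.
case: a b => x b [y c]; exists (y * x^-1, tperm b c); rewrite /col_act /=.
by rewrite mulgKV tpermV tpermL.
Qed.

Lemma col_act_faithful g : (forall a, col_act g a = a) -> g = 1.
Proof.
case: g => u s h; congr (_, _).
  by have [] := h (1, ord0); rewrite mulg1.
apply: invg_inj; rewrite invg1; apply/permP => b; rewrite perm1.
by have [] := h (1, b).
Qed.

Lemma col_act_nofix a : exists g, col_act g a <> a.
Proof.
have [g e] := col_act_trans a (a.1, if a.2 == ord0 then ord_max else ord0).
by exists g; rewrite e => /(congr1 snd) /=; case: eqP => [->|a0 /esym].
Qed.

Lemma fiber_act_col h g a : fiber_act h (col_act g a) = col_act g (fiber_act h a).
Proof. by rewrite /fiber_act /col_act /= mulgA. Qed.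

Lemma fiber_act1 a : fiber_act 1 a = a.
Proof. by case: a => x b; rewrite /fiber_act /= invg1 mulg1. Qed.

Lemma fiber_actM h k a : fiber_act (h * k) a = fiber_act h (fiber_act k a).
Proof. by rewrite /fiber_act /= invMg mulgA. Qed.

Lemma fiber_act_free h a : fiber_act h a = a -> h = 1.
Proof.
by case: a => x b [] e; apply: invg_inj; apply: (mulgI x); rewrite e invg1 mulg1.
Qed.

(** The stabilizer of [b] in ['S_3] fixes no other point, so [tau] keeps each fiber; by transitivity
    its value at [(1, ord0)] determines it. *)
Lemma col_centraliser (tau : letters -> letters) :
    (forall g a, tau (col_act g a) = col_act g (tau a)) ->
  exists h, tau =1 fiber_act h.
Proof.
move=> tau_eq.
have fib (x : H) b : (tau (x, b)).2 = b.
  apply/eqP; apply: contraT => bc; set c := _.2 in bc.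
  (* The third fiber makes [tperm c d] fix [b] and move [c]. *)
  have [d [db dc]] : exists d : 'I_3, d != b /\ d != c.
    have : (0 < #|~: [set b; c]|)%N.
      by have := cardsC [set b; c]; rewrite cards2 card_ord; case: (_ != _); lia.
    by case/card_gt0P => d; rewrite !inE negb_or => /andP[]; exists d.
  have := tau_eq (1, tperm c d) (x, b); rewrite /col_act /= tpermV !mul1g.
  rewrite tpermD //; move=> /(congr1 snd) /=; rewrite -/c tpermL.
  by move=> cd; rewrite -cd eqxx in dc.
exists (tau (1, ord0)).1^-1 => -[x b].
have := tau_eq (x, tperm b ord0) (1, ord0).
rewrite /col_act /= tpermV tpermR mulg1 fib => ->.
by rewrite /fiber_act /= tpermR invgK.
Qed.

Lemma card_cols : (1 < #|{: cols}|)%N.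
Proof.
have H0 : (0 < #|H|)%N by apply/card_gt0P; exists 1.
by rewrite card_prod card_Sn; apply: (@leq_trans (1 * 3`!)) => //; exact: leq_mul.
Qed.

End Letters.

(** [P] acts by left multiplication on the first [#|P|] indices, identified with its elements, and
    trivially on the rest. *)
Lemma cayley_action (P : finGroupType) (l : nat) : (#|P| <= l)%N ->
  exists pact : P -> 'I_l -> 'I_l,
    [/\ forall i, pact 1%g i = i,
        forall p q i, pact (p * q)%g i = pact p (pact q i)
      & forall p, (forall i, pact p i = i) -> p = 1%g].
Proof.
move=> Pl; pose w := widen_ord Pl.
pose f (p : P) (i : 'I_l) := if insub (val i) is Some j
  then w (enum_rank (p * enum_val (j : 'I_#|P|))%g) else i.
have fw p q : f p (w (enum_rank q)) = w (enum_rank (p * q)%g).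
  rewrite /f; case: insubP => [j _ /val_inj ->|]; first by rewrite enum_rankK.
  by rewrite /= ltn_ord.
have case_w i : (exists q, i = w (enum_rank q)) \/ forall p, f p i = i.
  rewrite /f; case: insubP => [j _ ji|]; last by right.
  by left; exists (enum_val j); rewrite enum_valK; apply: val_inj.
exists f; split=> [i|p q i|p fp].
- by case: (case_w i) => [[q ->]|//]; rewrite fw mul1g.
- by case: (case_w i) => [[r ->]|fi]; rewrite ?fw ?mulgA ?fi.
have := fp (w (enum_rank 1%g)); rewrite fw mulg1 => /(congr1 val) /= /ord_inj.
exact: enum_rank_inj.
Qed.

Theorem theorem41 (P : finGroupType) :
  exists c : nat, forall (H : finGroupType) (l : nat), (c <= l)%N ->
  exists (A : finType) (rho : rect_subst l A),
    [/\ aperiodic_subst rho, primitive_subst rho & bijective_subst rho] /\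
    isomorphic (symmetry_group rho)
      (Algebra.to_multiplicative 'rV[int]_l * H)%type /\
    exists theta : gaut_action P (Algebra.to_multiplicative 'rV[int]_l * H)%type,
      isomorphic (extended_symmetry_group rho) (sdprod_type theta).
Proof.
(* Cayley's action takes [#|P|] coordinates; as [#|P|] is positive, so is [l]. *)
exists #|P| => H l Pl.
have l_gt0 : (0 < l)%N by apply: leq_trans Pl; apply/card_gt0P; exists 1%g.
have [pact [pact1 pactM pact_faithful]] := cayley_action Pl.
pose G : finGroupType := (H * 'S_3)%type.
pose th := mark_col G pact.
have N_gt0 : (0 < radius l G)%N.
  by rewrite muln_gt0 l_gt0; apply/card_gt0P; exists 1%g.
have th0 : th 0 = 1%g := mark_col0 G pact l_gt0.
have th_onto : forall g : G, exists2 u, small (radius l G) u & th u = g.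
  exact: mark_col_onto.
have cardG_dvd : (#|G| %| radius l G)%N by exact: dvdn_mull.
have th_line := mark_col_line l_gt0 pact1 : forall (g : G) i, _.
have th_psite := mark_col_psite G l_gt0 pact1 pactM.
have th_rigid eps pi := @mark_col_rigid l G P pact l_gt0 pact1 eps pi (card_cols H).
exists (H * 'I_3)%type, (col_subst (@col_act H) th N_gt0).
have a0 : H * 'I_3 := (1%g, ord0).
split; [split | split].
- exact: (aperiodic_col_subst (@col_act1 H) (@col_actM H) th0 cardG_dvd
    (@col_act_nofix H) th_line).
- exact: (primitive_col_subst N_gt0 (@col_act_trans H) th_onto).
- exact: (bijective_col_subst (@col_act1 H) (@col_actM H)).
- exact: (symmetry_iso N_gt0 (@col_act1 H) (@col_actM H) th0 (@col_act_trans H)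
    th_onto cardG_dvd (@col_act_nofix H) th_line (@col_act_faithful H) th_psite
    th_rigid pact1 pactM pact_faithful (@fiber_act1 H) (@fiber_actM H)
    (@fiber_act_free H) (@fiber_act_col H) (@col_centraliser H) a0).
exists (coord_action H pact1 pactM).
exact: (extended_symmetry_iso N_gt0 (@col_act1 H) (@col_actM H) th0 (@col_act_trans H)
    th_onto cardG_dvd (@col_act_nofix H) th_line (@col_act_faithful H) th_psite
    th_rigid pact1 pactM pact_faithful (@fiber_act1 H) (@fiber_actM H)
    (@fiber_act_free H) (@fiber_act_col H) (@col_centraliser H) a0).
Qed.
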